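(* For an abelian group $X$ the following conditions are equivalent: (1) the group $X$ admits no homomorphism onto the quasicyclic 2-group $C_{2^\infty}$; (2) each maximal subgroup in the minimal ideal of $\lambda(X)$ is topologically isomorphic to the compact topological group $\prod_{k\in\mathbb N}C_{2^k}^{\,q(X,C_{2^k})}$; (3) each maximal subgroup in the minimal ideal of $\lambda(X)$ is a topological group; (4) some maximal subgroup of the minimal ideal of $\lambda(X)$ is compact; (5) each minimal left ideal of $\lambda(X)$ is topologically isomorphic to the compact topological semigroup $\prod_{k\in\mathbb N}(C_{2^k}\times Z_k)^{q(X,C_{2^k})}$, where the finite cube $Z_k=2^{2^{k-1}-k}$ is endowed with the left zero multiplication; (6) $\lambda(X)$ contains a principal left ideal which is topologically isomorphic to the compact topological semigroup $\prod_{k\in\mathbb N}(C_{2^k}\wr Z_k^{Z_k})^{q(X,C_{2^k})}$.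
   Context: Superextension. $\mathsf P(X)$ is the power-set of $X$. A family $\mathcal L\subset\mathsf P(X)$ is linked if $A\cap B\ne\emptyset$ for all $A,B\in\mathcal L$, and maximal linked if it is linked and coincides with every linked family containing it. $\lambda(X)\subset\mathsf P(\mathsf P(X))$ is the set of maximal linked systems on $X$, with the subspace topology of $\mathsf P(\mathsf P(X))\cong\{0,1\}^{\mathsf P(X)}$ and the operation $\mathcal A\circ\mathcal B=\{A\subset X:\{x\in X:x^{-1}A\in\mathcal B\}\in\mathcal A\}$; it is a compact Hausdorff right-topological semigroup. The minimal ideal is the smallest two-sided ideal (the union of all minimal left ideals); its maximal subgroups are the largest subgroups containing its idempotents, with subspace topology. A principal left ideal of a semigroup $S$ is a set $Sx$, $x\in S$. ''Topologically isomorphic'' means there is a semigroup isomorphism that is a homeomorphism. Left zero multiplication is $xy=x$. For finite $k$ the objects $C_{2^k}$, $Z_k=\{0,1\}^{2^{k-1}-k}$, $C_{2^k}\wr Z_k^{Z_k}$ are finite and discrete; products carry the product topology. Numbers $q(X,C_{2^k})$. A nonempty subset $K\subset X$ is a 2-cogroup if for every $x\in K$ the shift $xK=Kx$ is a subgroup of $X$ disjoint from $K$; then $KK$ is a subgroup. For a maximal (under inclusion) 2-cogroup $K$ let $\mathrm{Stab}(K)=\{x:xKx^{-1}=K\}$, $\mathsf H(K)=\mathrm{Stab}(K)/KK$, and $[K]=\{xKx^{-1}:x\in X\}$; $q(X,G)$ is the number (cardinal) of classes $[K]$ of maximal 2-cogroups with $\mathsf H(K)\cong G$. (For abelian $X$,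 $[K]=\{K\}$ and $\mathsf H(K)=X/KK$.) Here $C_{2^k}=\{z\in\mathbb C:z^{2^k}=1\}$ for finite $k$ and $C_{2^\infty}=\bigcup_{k\ge1}C_{2^k}$. Wreath product. For a group $H$ and a set $A$, $A^A$ is the semigroup of all self-maps of $A$ under composition, and $H\wr A^A$ is the set $H^A\times A^A$ with operation $(h,f)*(h',f')=(h'',f\circ f')$, $h''(\alpha)=h(f'(\alpha))\cdot h'(\alpha)$ for $\alpha\in A$. *)

(* Defs.v *)
From HB Require Import structures.
From mathcomp Require Import all_boot all_order all_algebra.
From mathcomp Require Import complex.
From mathcomp Require Import all_classical all_reals all_analysis.
From mathcomp Require Import Rstruct.

Set Implicit Arguments.
Unset Strict Implicit.
Unset Printing Implicit Defensive.

Import GRing.Theory.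

Local Open Scope classical_set_scope.
Local Open Scope group_scope.

Section Semigroups.
Variables (T : Type) (op : T -> T -> T).
Implicit Types S I G : set T.

Definition is_left_ideal S I :=
  [/\ I `<=` S, I !=set0 & forall s a, S s -> I a -> I (op s a)].

Definition is_ideal S I :=
  is_left_ideal S I /\ forall s a, S s -> I a -> I (op a s).

Definition minimal_left_ideal S I :=
  is_left_ideal S I /\ forall J, is_left_ideal S J -> J `<=` I -> J = I.

Definition minimal_ideal S : set T := smallest (is_ideal S) set0.

Definition principal_left_ideal S I :=
  exists2 x, S x & I = [set op s x | s in S].

Definition is_group_with G (e : T) (inv : T -> T) :=
  [/\ G e,
      forall a b, G a -> G b -> G (op a b),
      forall a b c, G a -> G b -> G c -> op a (op b c) = op (op a b) c,
      forall a, G a -> op e a = a /\ op a e = a &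
      forall a, G a -> [/\ G (inv a), op (inv a) a = e & op a (inv a) = e]].

Definition is_subgroup S G :=
  G `<=` S /\ exists e inv, is_group_with G e inv.

(* The maximal subgroups of S lying in I: the largest subgroups of S that
   contain a given idempotent of I. *)
Definition maximal_subgroup_in S I G :=
  exists e, [/\ I e, op e e = e, is_subgroup S G, G e &
    forall H, is_subgroup S H -> H e -> H `<=` G].

End Semigroups.

Definition topological_group (T : topologicalType) (op : T -> T -> T)
    (G : set T) :=
  exists e inv,
    [/\ is_group_with op G e inv,
        {within G `*` G, continuous (fun p : T * T => op p.1 p.2)} &
        {within G, continuous inv}].

(* The subset A of T, with the subspace topology and the operation opT, is
   topologically isomorphic to the whole space U with the operation opU. *)
Definition top_isomorphic (T U : topologicalType) (opT : T -> T -> T)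
    (A : set T) (opU : U -> U -> U) :=
  exists (f : T -> U) (g : U -> T),
    [/\ (forall u, A (g u)) /\ (forall u, f (g u) = u),
        forall a, A a -> g (f a) = a,
        forall a b, A a -> A b -> f (opT a b) = opU (f a) (f b),
        {within A, continuous f} &
        continuous g].

Section Groups.
Variable X : groupType.
Implicit Types (x : X) (A B H K : set X).

Definition setmul A B : set X := [set a * b | a in A & b in B].
Definition lshift x A : set X := [set x * a | a in A].
Definition rshift A x : set X := [set a * x | a in A].
Definition conjset x A : set X := [set x * a * x^-1 | a in A].

Definition subgroup H :=
  [/\ H 1, forall a b, H a -> H b -> H (a * b) & forall a, H a -> H a^-1].

Definition cogroup2 K :=
  K !=set0 /\ forall x, K x ->
    [/\ lshift x K = rshift K x, subgroup (lshift x K) & lshift x K `&` K = set0].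

Definition maximal_cogroup2 K :=
  cogroup2 K /\ forall K', cogroup2 K' -> K `<=` K' -> K' = K.

Definition Stab K : set X := [set x | conjset x K = K].

(* The quotient Stab(K) / KK: the set of cosets of KK in Stab(K), to be used
   with the multiplication setmul. *)
Definition char_group K : set (set X) :=
  [set lshift x (setmul K K) | x in Stab K].

Definition char_group_isog K (G : groupType) :=
  exists f : set X -> G, set_bij (char_group K) setT f /\
    forall A B, char_group K A -> char_group K B ->
      f (setmul A B) = f A * f B.

Definition conj_class K : set (set X) := [set conjset x K | x in setT].

(* A set whose cardinality is the number q(X, G). *)
Definition q_classes (G : groupType) : set (set (set X)) :=
  [set C | exists K, [/\ maximal_cogroup2 K, char_group_isog K G &
                         C = conj_class K]].

(* P(P(X)) as the Cantor cube {0,1}^P(X). *)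
Definition PPset : topologicalType := {ptws set X -> bool}.

Definition linked (F : PPset) :=
  forall A B, F A -> F B -> A `&` B !=set0.

Definition superextension : set PPset :=
  [set F | linked F /\
     forall F' : PPset, linked F' -> (forall A, F A -> F' A) -> F' = F].

Definition superext_op (F G : PPset) : PPset :=
  fun A => F [set x | G (lshift x^-1 A)].

End Groups.

Arguments q_classes X G : clear implicits.
Arguments superextension X : clear implicits.
Arguments superext_op X : clear implicits.

Notation CC := (complex Rdefinitions.R).

Definition is_root2 (k : nat) (z : CC) : bool := (z ^+ (2 ^ k) == 1)%R.

Definition C2 (k : nat) : Type := {z : CC | is_root2 k z}.

Definition C2oo : set CC :=
  [set z | exists k : nat, (0 < k)%N /\ (z ^+ (2 ^ k) = 1)%R].

Section C2_group.
Variable k : nat.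
Implicit Types u v : C2 k.

HB.instance Definition _ := Choice.copy (C2 k) {z : CC | is_root2 k z}.

Fact C2_one_subproof : is_root2 k 1%R.
Proof. by rewrite /is_root2 expr1n. Qed.

Fact C2_mul_subproof u v : is_root2 k (val u * val v)%R.
Proof. by rewrite /is_root2 exprMn (eqP (valP u)) (eqP (valP v)) mulr1. Qed.

Fact C2_inv_subproof u : is_root2 k (val u)^-1%R.
Proof. by rewrite /is_root2 exprVn (eqP (valP u)) invr1. Qed.

Definition C2_one : C2 k := Sub _ C2_one_subproof.
Definition C2_mul u v : C2 k := Sub _ (C2_mul_subproof u v).
Definition C2_inv u : C2 k := Sub _ (C2_inv_subproof u).

Fact C2_mulA : associative C2_mul.
Proof. by move=> u v w; apply: val_inj; rewrite /= mulrA. Qed.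

Fact C2_mul1 : left_id C2_one C2_mul.
Proof. by move=> u; apply: val_inj; rewrite /= mul1r. Qed.

Fact C2_mulV : left_inverse C2_one C2_inv C2_mul.
Proof.
move=> u; apply: val_inj; rewrite /= mulVr // unitfE.
apply/eqP => u0; have := valP u.
by rewrite /is_root2 [val u]u0 expr0n expn_eq0 /= eq_sym oner_eq0.
Qed.

Fact C2_mulC : commutative C2_mul.
Proof. by move=> u v; apply: val_inj; rewrite /= mulrC. Qed.

Fact C2_mulr1 : right_id C2_one C2_mul.
Proof. by move=> u; rewrite C2_mulC C2_mul1. Qed.

Fact C2_mulrV : right_inverse C2_one C2_inv C2_mul.
Proof. by move=> u; rewrite C2_mulC C2_mulV. Qed.

HB.instance Definition _ :=
  isGroup.Build (C2 k) C2_mulA C2_mul1 C2_mulr1 C2_mulV C2_mulrV.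

End C2_group.

(* Only used for k >= 1, where k <= 2 ^ (k - 1). *)
Definition Zcube (k : nat) : Type := {ffun 'I_(2 ^ k.-1 - k) -> bool}.
HB.instance Definition _ k := Finite.copy (Zcube k) {ffun 'I_(2 ^ k.-1 - k) -> bool}.

Definition leftzero_mul (T : Type) (x y : T) : T := x.

Definition pair_mul (T U : Type) (opT : T -> T -> T) (opU : U -> U -> U)
    (x y : T * U) : T * U :=
  (opT x.1 y.1, opU x.2 y.2).

Definition wreath (H : groupType) (A : finType) : Type :=
  ({ffun A -> H} * {ffun A -> A})%type.
HB.instance Definition _ H A := Choice.copy (wreath H A) ({ffun A -> H} * {ffun A -> A})%type.

Definition wreath_mul (H : groupType) (A : finType) (x y : wreath H A) :
    wreath H A :=
  ([ffun a => x.1 (y.2 a) * y.1 a], [ffun a => x.2 (y.2 a)]).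

Section PowerProduct.
Variables (X : groupType) (D : nat -> choiceType).
Variable op : forall k, D k -> D k -> D k.

(* The product over k >= 1 of the powers D(k)^q(X, C_{2^k}) of discrete
   spaces; the index k runs over nat and stands for k.+1. *)
Definition qprod : topologicalType :=
  prod_topology (fun k : nat =>
    prod_topology (fun _ : q_classes X (C2 k.+1) => discrete_topology (D k.+1))).

Definition qprod_mul (f g : qprod) : qprod := fun k c => op (f k c) (g k c).

End PowerProduct.
Arguments qprod : clear implicits.

(* Main.v *)
(* A maximal linked system F is determined by the map A |-> {x : x^-1 A in F} of
   the power set, and the operation becomes composition. Fix a maximal linked
   system I among the shift-invariant ones. On an abelian group every set that is
   not twin (xA = X \ A for some x) is decided by I, and the twin sets form an
   antichain, so the maximal linked systems containing I are the arbitrary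
   equivariant self-maps of the family of twin sets. Such a map can only enlarge
   the 2-cogroup {x : xA = X \ A}. Retracting the twin sets onto those with a
   maximal 2-cogroup K gives the principal left ideal of (6); collapsing moreover,
   for each K, the twin sets of K to a single orbit gives a minimal left ideal. On
   the twin sets of K the group X/KK acts freely, and X/KK is C_{2^k} or
   C_{2^oo}; in the first case there are 2^(2^(k-1)) twin sets, and counting the
   orbits yields C_{2^k} x Z_k. If some X/KK is C_{2^oo}, every maximal subgroup
   maps continuously onto a countable infinite homogeneous orbit, which is not
   compact, and when this orbit consists of the rotations of a half-open
   half-circle, inversion is discontinuous. *)
From HB Require Import structures.
Require Import Defs.
From mathcomp Require Import all_boot all_order all_algebra.
From mathcomp Require Import complex.
From mathcomp Require Import all_classical all_reals all_analysis.
From mathcomp Require Import Rstruct.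

Local Open Scope classical_set_scope.
Local Open Scope group_scope.

(** Commutativity makes [Fixm] constant along orbits and twin sets incomparable, so that on twin
    sets inclusion imposes nothing beyond equivariance. In X/KK the 2-cogroup K is a single
    involution; maximality of K puts this involution in every nontrivial subgroup, and this is what
    leaves only cyclic and quasicyclic quotients. For the topology, an element of the ideals in (5)
    and (6) has a fixed right factor that first sends a set A to X, to the empty set, or to a twin
    set of one K. Its value at A therefore reads at most one coordinate of the product. This gives
    continuity of the parametrization, and compactness of the product does the rest. The two
    failures caused by C_{2^oo} differ in scope. Compactness fails in every maximal subgroup, since
    all of them see the whole orbit. Discontinuity of inversion depends on the orbit, so a maximal
    subgroup has to be built around a suitable one. This matches the quantifiers in (3) and (4). *)

Local Notation "x ** A" := (Defs.lshift x A) (at level 40, no associativity).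

(** * Shifts, and maximal linked systems as equivariant maps of the power set *)

Section Translates.
Context {X : groupType}.
Implicit Types (x y : X) (A B : set X) (F G H : PPset X).

(* The function representation of F, under which the operation of the
   superextension becomes the composition of maps (see [tr_op]). *)
Definition tr F A : set X := [set x | F (x^-1 ** A)].

Lemma lshiftE x A : x ** A = [set y | A (x^-1 * y)].
Proof.
apply/seteqP; split=> y /=.
  by move=> [a Aa <-]; rewrite mulgA mulVg mul1g.
by move=> Ay; exists (x^-1 * y) => //; rewrite mulgA mulgV mul1g.
Qed.

Lemma lshift1 A : 1 ** A = A.
Proof. by rewrite lshiftE; apply/seteqP; split=> y /=; rewrite invg1 mul1g. Qed.

Lemma lshiftM x y A : (x * y) ** A = x ** (y ** A).
Proof.
by rewrite !lshiftE; apply/seteqP; split=> z /=; rewrite invgM mulgA.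
Qed.

Lemma lshiftK x A : x^-1 ** (x ** A) = A.
Proof. by rewrite -lshiftM mulVg lshift1. Qed.

Lemma lshiftVK x A : x ** (x^-1 ** A) = A.
Proof. by rewrite -lshiftM mulgV lshift1. Qed.

Lemma lshiftC x A : x ** (~` A) = ~` (x ** A).
Proof. by rewrite !lshiftE. Qed.

Lemma lshiftS x A B : A `<=` B -> x ** A `<=` x ** B.
Proof. by rewrite !lshiftE => AB y /AB. Qed.

Lemma lshiftT x : x ** setT = setT.
Proof. by rewrite lshiftE. Qed.

Lemma lshift0 x : x ** set0 = set0.
Proof. by rewrite lshiftE. Qed.

Lemma lshift_inj x : injective (Defs.lshift x).
Proof. by move=> A B /(congr1 (Defs.lshift x^-1)); rewrite !lshiftK. Qed.

Lemma tr_lshift F x A : tr F (x ** A) = x ** (tr F A).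
Proof.
rewrite (lshiftE x (tr F A)) /tr; apply/seteqP; split=> y /=;
  by rewrite -lshiftM invgM invgK.
Qed.

Lemma tr1 F A : tr F A 1 = F A.
Proof. by rewrite /tr /= invg1 lshift1. Qed.

Lemma tr_op F G A : tr (superext_op X F G) A = tr F (tr G A).
Proof. by apply/seteqP; split=> x; rewrite /tr /superext_op /= -tr_lshift. Qed.

Lemma tr_inj F G : (forall A, tr F A = tr G A) -> F = G.
Proof.
move=> FG; apply: funext => A; have := congr1 (fun B => B 1) (FG A).
by rewrite !tr1 => e; apply/idP/idP; rewrite ?e // -e.
Qed.

Lemma superext_opA F G H :
  superext_op X F (superext_op X G H) = superext_op X (superext_op X F G) H.
Proof. by apply: tr_inj => A; rewrite !tr_op. Qed.

(** Maximality says that a nonempty set meeting every member is a member. This closes [F] upwards;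
    and if [A] is not a member, some member misses it and so lies in the complement. *)
Lemma superextensionP F : superextension X F <->
  (forall A B, A `<=` B -> F A -> F B) /\ (forall A, F (~` A) = ~~ F A).
Proof.
split=> [[lF maxF]|[monF symF]]; last first.
  have lF : linked F.
    move=> A B FA FB; apply: contrapT => /set0P/negP/negPn/eqP AB0.
    suff: F (~` A) by rewrite symF FA.
    by apply: monF FB; apply/disjoints_subset; rewrite setIC.
  split=> // F' lF' FF'; apply: funext => A; apply/idP/idP; last exact: FF'.
  move=> F'A; apply: contraT; rewrite -symF => /FF' F'cA.
  by have [x []] := lF' _ _ F'A F'cA.
have add B : B !=set0 -> (forall A, F A -> A `&` B !=set0) -> F B.
  move=> B0 FB; pose F' : PPset X := fun A => F A || `[< A = B >].
  rewrite -(maxF F'); first by rewrite /F'; apply/orP; right; apply/asboolP.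
    move=> A C /orP[FA|/asboolP->] /orP[FC|/asboolP->]; first exact: lF.
    - exact: FB.
    - by rewrite setIC; exact: FB.
    - by rewrite setIid.
  by move=> A FA; rewrite /F' FA.
have ne A : F A -> A !=set0 by move=> FA; have := lF _ _ FA FA; rewrite setIid.
have mon A B : A `<=` B -> F A -> F B.
  move=> AB FA; apply: add; first by have [x Ax] := ne _ FA; exists x; exact: AB.
  by move=> C FC; have [x [Cx Ax]] := lF _ _ FC FA; exists x; split=> //; exact: AB.
split=> // A; apply/idP/idP.
  by move=> FcA; apply/negP => FA; have [x []] := lF _ _ FA FcA.
move=> nFA; apply: contrapT => nFcA.
have FT : F setT.
  by apply: add; [exists 1 | move=> C /ne; rewrite setIT].
move/negP: nFA; apply; apply: add.
  apply: contrapT => /set0P/negP/negPn/eqP A0; apply: nFcA.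
  by rewrite A0 setC0.
move=> C FC; apply: contrapT => /set0P/negP/negPn/eqP CA0; apply: nFcA.
by apply: mon FC; apply/disjoints_subset.
Qed.

Lemma trS F A B : superextension X F -> A `<=` B -> tr F A `<=` tr F B.
Proof. by move=> /superextensionP[monF _] AB x; apply/monF/lshiftS. Qed.

Lemma trC F A : superextension X F -> tr F (~` A) = ~` tr F A.
Proof.
move=> /superextensionP[_ symF]; apply/seteqP; split=> x;
  by rewrite /tr /= lshiftC symF => /negP.
Qed.

Lemma trT F : superextension X F -> tr F setT = setT.
Proof.
move=> sF; have := trC F setT sF; rewrite setCT => F0.
have := trS F set0 setT sF (@sub0set _ _); rewrite F0.
rewrite -subTset => h x _; have [//|/h//] := pselect (tr F setT x).
Qed.

Lemma tr0 F : superextension X F -> tr F set0 = set0.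
Proof. by move=> sF; rewrite -setCT trC// trT// setCT. Qed.

Lemma superextension_op F G :
  superextension X F -> superextension X G -> superextension X (superext_op X F G).
Proof.
move=> sF sG; apply/superextensionP; split=> [A B AB|A].
  by rewrite -!tr1 !tr_op; apply: trS => //; apply: trS.
by have /superextensionP[_ symF] := sF; rewrite -symF -[LHS]/(F (tr G (~` A))) trC.
Qed.

End Translates.

(** * Twin sets and equivariant maps *)

Section Twins.
Context {X : groupType} (abX : forall x y : X, x * y = y * x).
Implicit Types (x y : X) (A B C : set X) (F G H : PPset X).

Lemma lshiftCA x y A : x ** (y ** A) = y ** (x ** A).
Proof. by rewrite -!lshiftM abX. Qed.

Definition Fixm A : set X := [set x | x ** A = ~` A].

Definition twin A := Fixm A !=set0.

Lemma Fixm_lshift x A : Fixm (x ** A) = Fixm A.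
Proof.
apply/seteqP; split=> y /=; rewrite /Fixm /= lshiftCA -lshiftC; last by move=> ->.
exact: lshift_inj.
Qed.

Lemma Fixm_C A : Fixm (~` A) = Fixm A.
Proof.
by apply/seteqP; split=> x; rewrite /Fixm /= lshiftC; [move/(congr1 setC)|move->];
  rewrite !setCK.
Qed.

Lemma twin_lshift x A : twin (x ** A) <-> twin A.
Proof. by rewrite /twin Fixm_lshift. Qed.

Lemma not_twinT : ~ twin [set: X].
Proof.
by move=> [x]; rewrite /Fixm /= lshiftT setCT => /seteqP[/(_ 1 Logic.I)].
Qed.

Lemma not_twin0 : ~ twin (@set0 X).
Proof. by rewrite -setCT /twin Fixm_C; exact: not_twinT. Qed.

(** An element fixing [A] is a quotient of two elements of [Fixm A], and both of these flip [B] as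
    well. *)
Lemma stab_Fixm A B x : twin A -> Fixm A `<=` Fixm B -> x ** A = A -> x ** B = B.
Proof.
move=> [a Aa] AB xA; have Aax : Fixm A (x * a).
  by rewrite /Fixm /= lshiftM Aa lshiftC xA.
have := AB _ Aax; rewrite /Fixm /= lshiftM (AB _ Aa) lshiftC => e.
by rewrite -[LHS]setCK e setCK.
Qed.

(** Complementing the inclusions gives y(X \ A) ⊂ A ⊂ x(X \ A). As shifts commute, X \ A ⊂ yA ⊂ yx(X
    \ A) = xy(X \ A) ⊂ xA. *)
Lemma pretwin_twin A x y :
  x ** A `<=` ~` A -> ~` A `<=` y ** A -> x ** A = ~` A.
Proof.
move=> xA Ay; apply/seteqP; split=> //.
have yA : y ** (~` A) `<=` A by rewrite lshiftC -[X in _ `<=` X]setCK; apply: subsetC.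
have Ax : A `<=` x ** (~` A) by rewrite lshiftC -[X in X `<=` _]setCK; apply: subsetC.
apply: subset_trans Ay _; apply: subset_trans (lshiftS y _ _ Ax) _.
by rewrite lshiftCA; apply: lshiftS.
Qed.

(** The [x] that flips [A] also flips [B]: X \ B ⊂ xB follows from the inclusion of [A] in [B], and
    shifting this by [y] gives the converse. Applying [x] then reverses the inclusion of [A] in
    [B]. *)
Lemma twin_antichain A B : twin A -> twin B -> A `<=` B -> A = B.
Proof.
move=> [x Ax] [y By] AB; have yB : y ** B = ~` B by [].
have BxB : ~` B `<=` x ** B.
  by apply: subset_trans (subsetC AB) _; rewrite -Ax; apply: lshiftS.
have xB : x ** B = ~` B.
  apply/seteqP; split=> //.
  have : y ** (~` B) `<=` x ** (~` B).
    by rewrite -yB (lshiftCA x y); apply: lshiftS; rewrite yB.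
  by rewrite !lshiftC yB setCK => /subsetC; rewrite setCK.
apply/seteqP; split=> //.
rewrite -[X in X `<=` _]setCK -[X in _ `<=` X]setCK -Ax -xB.
by apply/subsetC/lshiftS.
Qed.

Lemma Fixm_tr F A : superextension X F -> Fixm A `<=` Fixm (tr F A).
Proof. by move=> sF x Ax; rewrite /Fixm /= -tr_lshift Ax trC. Qed.

Lemma twin_tr F A : superextension X F -> twin A -> twin (tr F A).
Proof. by move=> sF [x /(Fixm_tr _ _ sF)]; exists x. Qed.

(** Zorn's lemma gives a maximal family. If neither a set nor its complement can be added, each of
    the two is disjoint from one of its shifts, which is the hypothesis of [pretwin_twin]. *)
Lemma exists_invariant_linked : exists I : set (set X),
  [/\ forall A B, A `<=` B -> I A -> I B,
      forall x A, I A -> I (x ** A),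
      forall A, I A -> ~ I (~` A) &
      forall A, [\/ I A, I (~` A) | twin A]].
Proof.
pose P (I : set (set X)) := (forall x A, I A -> I (x ** A)) /\
  (forall A B, I A -> I B -> A `&` B !=set0).
have [|I [[invI lI] maxI]] := @Zorn_bigcup _ P.
  move=> C CP totC; split=> [x A [J CJ JA]|A B [J CJ JA] [J' CJ' JB]].
    by exists J => //; exact: (CP _ CJ).1.
  have [JJ|JJ] := totC _ _ CJ CJ'; first exact: (CP _ CJ').2 (JJ _ JA) JB.
  exact: (CP _ CJ).2 JA (JJ _ JB).
(* [add] is maximality: an orbit that is linked and meets [I] lies in [I]. *)
have add A : (forall x, A `&` (x ** A) !=set0) ->
    (forall B, I B -> B `&` A !=set0) -> I A.
  move=> lA IA; apply: contrapT => nIA.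
  apply: (maxI (I `|` [set B | exists x, B = x ** A])).
    split; first exact: subsetUl.
    by move=> /(_ A) h; apply/nIA/h; right; exists 1; rewrite lshift1.
  have IxA B x : I B -> B `&` (x ** A) !=set0.
    move=> IB; have [y [By Ay]] := IA _ (invI x^-1 _ IB).
    exists (x * y); split; last by rewrite lshiftE /= mulKg.
    by rewrite lshiftE /= invgK in By.
  split=> [x B [IB|[y ->]]|B C [IB|[y ->]] [IC|[z ->]]].
  - by left; exact: invI.
  - by right; exists (x * y); rewrite lshiftM.
  - exact: lI.
  - exact: IxA.
  - by rewrite setIC; exact: IxA.
  - have [w [Aw yzw]] := lA (y^-1 * z); exists (y * w).
    by rewrite !lshiftE /= mulKg mulgA; rewrite lshiftE /= invgM invgK in yzw.
have disj (A B : set X) : ~ (A `&` B !=set0) -> A `<=` ~` B.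
  by move=> /set0P/negP/negPn/eqP/disjoints_subset.
have up A B : A `<=` B -> I A -> I B.
  move=> AB IA; apply: add => [x|C IC].
    have [y [Ay xAy]] := lI _ _ IA (invI x _ IA).
    by exists y; split; [exact: AB | exact: lshiftS AB _ _].
  by have [y [Cy Ay]] := lI _ _ IC IA; exists y; split=> //; exact: AB.
exists I; split=> // [A IA IcA|A].
  by have [x []] := lI _ _ IA IcA.
have dich B : I B \/ I (~` B) \/ exists x, x ** B `<=` ~` B.
  have [IB|nIB] := pselect (I B); [by left|right].
  have [[x xB]|nx] := pselect (exists x, ~ (B `&` (x ** B) !=set0)).
    by right; exists x; apply: disj; rewrite setIC.
  left; apply: contrapT => nIcB; apply/nIB/add.
    by move=> x; apply: contrapT => h; apply: nx; exists x.
  move=> C IC; apply: contrapT => CB; apply: nIcB.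
  by apply: up IC; exact: disj.
have [|[|[x xA]]] := dich A; [by constructor 1|by constructor 2|].
have [|[|[y yA]]] := dich (~` A); [by constructor 2| |].
  by rewrite setCK; constructor 1.
constructor 3; exists x; apply: (@pretwin_twin _ _ y) => //.
by move/subsetC: yA; rewrite lshiftC !setCK.
Qed.

(* Equivariance along the orbit of A is consistent because the stabilizer of A
   is generated by products of two elements of [Fixm A]. *)
Lemma equivariant_choice (P : set X -> set X -> Prop) :
    (forall A, twin A -> exists2 B, P A B & Fixm A `<=` Fixm B) ->
    (forall x A B, P A B -> P (x ** A) (x ** B)) ->
  exists phi : set X -> set X,
    [/\ forall A, twin A -> P A (phi A),
        forall x A, twin A -> phi (x ** A) = x ** phi A &
        forall A, twin A -> Fixm A `<=` Fixm (phi A)].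
Proof.
move=> exP invP.
pose orb A := [set B | exists x, B = x ** A].
(* The choice sees only the set [orb A], so all members of an orbit get the same representative. *)
pose rep A := xget set0 (orb A).
have repP A : exists x, A = x ** rep A.
  have : orb A (rep A) by apply: (@xgetPex _ set0); exists A; exists 1; rewrite lshift1.
  by move=> [x ->]; exists x^-1; rewrite lshiftK.
have rep_lshift x A : rep (x ** A) = rep A.
  rewrite /rep; congr xget; apply/seteqP; split=> B [y ->].
    by exists (y * x); rewrite lshiftM.
  by exists (y * x^-1); rewrite lshiftM lshiftK.
have [mv mvP] := choice repP.
have /choice[c cP] A : exists B, twin A -> P A B /\ Fixm A `<=` Fixm B.
  have [/exP[B PB AB]|nA] := pselect (twin A); first by exists B.
  by exists set0.
have twin_rep A : twin A -> twin (rep A).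
  by move=> tA; apply/(twin_lshift (mv A)); rewrite -mvP.
exists (fun A => mv A ** c (rep A)); split=> [A tA|x A tA|A tA].
- by rewrite [X in P X]mvP; apply/invP/(cP _ (twin_rep _ tA)).1.
- rewrite rep_lshift -lshiftM; have [_ sub] := cP _ (twin_rep _ tA).
  apply: (@lshift_inj _ (x * mv A)^-1); rewrite lshiftK -lshiftM.
  apply: stab_Fixm sub _; first exact: twin_rep.
  rewrite lshiftM; apply: (@lshift_inj _ (x * mv A)); rewrite lshiftVK lshiftM.
  by rewrite -mvP -[in LHS](rep_lshift x A) -mvP.
- rewrite [X in Fixm X `<=` _]mvP !Fixm_lshift.
  by have [] := cP _ (twin_rep _ tA).
Qed.

(** [F] consists of the invariant family and of the twin sets whose image under an equivariant [phi]
    contains 1; [twin_antichain] keeps it upward closed. [P] is a relation, so that later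
    constructions state only what they need of [phi], and the choice along orbits is made here
    once. *)
Lemma superextension_ext (P : set X -> set X -> Prop) :
    (forall A, twin A -> exists2 B, P A B & Fixm A `<=` Fixm B) ->
    (forall x A B, P A B -> P (x ** A) (x ** B)) ->
  exists F, [/\ superextension X F, forall A, twin A -> P A (tr F A) &
    forall A, ~ twin A -> tr F A = setT \/ tr F A = set0].
Proof.
move=> exP invP; have [I [upI invI linkI decI]] := exists_invariant_linked.
have [phi [Pphi phiM phiF]] := equivariant_choice P exP invP.
have twinI A : twin A -> ~ I A.
  by move=> [x Ax] IA; apply: (linkI A) => //; rewrite -Ax; exact: invI.
have twinC A : twin (~` A) <-> twin A. by rewrite /twin Fixm_C.
have phiC A : twin A -> phi (~` A) = ~` phi A.
  by move=> tA; have [x Ax] := tA; rewrite -Ax phiM// (phiF A tA x Ax).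
have phi_mon A B : twin A -> twin B -> A `<=` B -> A = B by exact: twin_antichain.
pose F : PPset X := fun A => `[< I A \/ (twin A /\ phi A 1) >].
have sF : superextension X F.
  apply/superextensionP; split=> [A B AB /asboolP FA|A]; rewrite /F.
    apply/asboolP; case: FA => [IA|[tA phiA]]; first by left; exact: upI IA.
    have [IB|IcB|tB] := decI B; [by left| |by right; rewrite -(phi_mon A B)].
    exfalso; apply: (twinI (~` A)); first exact/twinC.
    by apply: upI IcB; exact: subsetC.
  rewrite -asbool_neg; apply: asbool_equiv_eq; split.
    move=> [IcA|[/twinC tA phicA]] [IA|[tA' phiA]].
    - exact: linkI IA IcA.
    - by apply: twinI IcA; exact/twinC.
    - exact: twinI IA.
    - by rewrite phiC in phicA.
  move=> nA; have [IA|IcA|tA] := decI A; [by case: nA; left|by left|right].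
  by split; [exact/twinC|rewrite phiC// => phiA; apply: nA; right].
exists F; split=> // A tA.
  suff -> : tr F A = phi A by exact: Pphi.
  have FE x : F (x^-1 ** A) <-> phi A x.
    have -> : phi A x <-> phi (x^-1 ** A) 1.
      by rewrite phiM// lshiftE /= invgK mulg1.
    split=> [/asboolP[/twinI []|[]//]|]; first exact/twin_lshift.
    by move=> h; apply/asboolP; right; split=> //; exact/twin_lshift.
  by apply/seteqP; split=> x /FE.
have [IA|IcA|//] := decI A; [left|right].
  by apply/seteqP; split=> // x _; apply/asboolP; left; exact: invI.
apply/seteqP; split=> // x /asboolP[IA|[/twin_lshift//]].
by apply: (linkI A _ IcA); rewrite -[A](lshiftVK x); exact: invI.
Qed.

End Twins.

(** * 2-cogroups *)

Section Cogroups.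
Context {X : groupType} (abX : forall x y : X, x * y = y * x).
Implicit Types (x y z : X) (A B C : set X) (K N : set X).

Lemma mulACg x y z : x * y * z = x * z * y.
Proof. by rewrite -!mulgA (abX y). Qed.

(** The conditions on the right make [K] a coset of order two modulo the subgroup KK. Being
    elementwise, they pass easily to unions of chains. *)
Lemma cogroup2P K : cogroup2 K <-> [/\ K !=set0,
  forall a b c, K a -> K b -> K c -> K (a * b * c),
  forall a, K a -> K a^-1 & forall a b, K a -> K b -> ~ K (a * b)].
Proof.
split=> [[K0 cK]|[K0 K3 KV K2]].
  have KV a : K a -> K a^-1.
    move=> Ka; have [_ [+ _ _] _] := cK a Ka.
    by rewrite lshiftE /= mulg1.
  split=> // [a b c Ka Kb Kc|a b Ka Kb Kab].
    have [_ [_ KM _] _] := cK c Kc.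
    have := KM _ _ (ex_intro2 _ _ a Ka erefl) (ex_intro2 _ _ b Kb erefl).
    by rewrite lshiftE /= -mulgA mulKg (abX c) mulgA.
  have [_ _ K0'] := cK a Ka.
  by suff: (set0 : set X) (a * b) by []; rewrite -K0'; split=> //; exists b.
split=> // x Kx; split.
- by apply/seteqP; split=> _ [a Ka <-]; exists a.
- split=> [|_ _ [a Ka <-] [b Kb <-]|_ [a Ka <-]].
  + by exists x^-1; [exact: KV|rewrite mulgV].
  + by exists (a * x * b); [exact: K3|rewrite !mulgA].
  + exists (x^-1 * a^-1 * x^-1); first by apply: K3; exact: KV.
    by rewrite invgM !mulgA mulgV mul1g.
- by apply/seteqP; split=> // _ [[a Ka <-]]; exact: K2.
Qed.

Lemma setmulKP K x y : cogroup2 K -> K y -> setmul K K x <-> K (x * y).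
Proof.
move=> /cogroup2P[K0 K3 KV K2] Ky; split=> [[a Ka [b Kb <-]]|Kxy].
  exact: K3.
by exists (x * y) => //; exists y^-1; [exact: KV|rewrite mulgK].
Qed.

Lemma setmul_subgroup K : cogroup2 K -> subgroup (setmul K K).
Proof.
move=> cK; have /cogroup2P[[y Ky] K3 KV K2] := cK.
split=> [|a b /setmulKP h1 /setmulKP h2|a [x Kx [z Kz <-]]].
- by apply/(setmulKP _ _ _ cK Ky); rewrite mul1g.
- apply/(setmulKP _ _ _ cK Ky).
  have := K3 _ _ _ (h1 _ cK Ky) (h2 _ cK Ky) (KV _ Ky).
  by rewrite !mulgA mulgK -(mulgA a) (abX y) !mulgA.
- by exists z^-1; [exact: KV|exists x^-1; [exact: KV|rewrite invgM]].
Qed.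

Lemma setmulK_disjoint K x : cogroup2 K -> K x -> ~ setmul K K x.
Proof.
by move=> cK Kx; have /cogroup2P[_ _ _ K2] := cK; move/(setmulKP _ _ _ cK Kx); apply: K2.
Qed.

Lemma setmulKM K x y : cogroup2 K -> setmul K K x -> K y -> K (x * y).
Proof. by move=> cK Kx Ky; apply/setmulKP. Qed.

Lemma cogroup2X K x n : cogroup2 K -> K x ->
  if odd n then K (x ^+ n) else setmul K K (x ^+ n).
Proof.
move=> cK Kx; elim: n => [|n]; first by have [] := setmul_subgroup _ cK.
rewrite expgS /=; case: (odd n) => /= h; first by exists x => //; exists (x ^+ n).
by rewrite abX; exact: (setmulKM _ _ _ cK h Kx).
Qed.

Lemma cogroup2_Fixm A : twin A -> cogroup2 (Fixm A).
Proof.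
move=> tA; apply/cogroup2P; split=> // [a b c Aa Ab Ac|a Aa|a b Aa Ab].
- by rewrite /Fixm /= !lshiftM Ac lshiftC Ab setCK Aa.
- rewrite /Fixm /=; apply: (@lshift_inj _ a).
  by rewrite lshiftVK lshiftC Aa setCK.
- rewrite /Fixm /= lshiftM Ab lshiftC Aa setCK => /seteqP[A0 A1].
  by have [/[dup] /A0|/[dup] /A1] := EM (A 1).
Qed.

(** In each coset of the subgroup KK ∪ K, one of its two cosets of KK is chosen. An element of [K]
    exchanges the two, hence carries the union of the chosen ones to its complement. *)
Lemma exists_Fixm_sup K : cogroup2 K -> exists A, K `<=` Fixm A.
Proof.
move=> cK; have /cogroup2P[[k0 Kk0] K3 KV K2] := cK.
have [N1 NM NV] := setmul_subgroup _ cK; set N := setmul K K in N1 NM NV.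
pose co x := [set y | N (y * x^-1) \/ K (y * x^-1)].
pose r x := xget 1 (co x).
have coM a x : K a -> co (a * x) = co x.
  move=> Ka; have e y : y * (a * x)^-1 = a^-1 * (y * x^-1).
    by rewrite invgM mulgA abX.
  have e' y : y * x^-1 = a * (y * (a * x)^-1) by rewrite e mulVKg.
  apply/seteqP; split=> y [h|h]; rewrite /co /= ?e.
  - by right; rewrite e' abX; exact: (setmulKM _ _ _ cK h Ka).
  - by left; rewrite e'; exists a => //; exists (y * (a * x)^-1).
  - by right; rewrite (abX a^-1); exact: (setmulKM _ _ _ cK h (KV _ Ka)).
  - by left; exists a^-1; [exact: KV|exists (y * x^-1)].
have rP x : co x (r x).
  by apply: (@xgetPex _ 1); exists x; left; rewrite mulgV.
exists [set x | N (r x * x^-1)] => a Ka; rewrite /Fixm /= lshiftE.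
have rM x : r (a^-1 * x) = r x by rewrite /r coM//; exact: KV.
apply/seteqP; split=> x /=; rewrite rM invgM invgK mulgA => h.
  by move=> Nx; apply: (setmulK_disjoint _ a cK Ka); rewrite -(mulKg (r x * x^-1) a);
     apply: NM => //; exact: NV.
have [//|Kx] := rP x; by exists (r x * x^-1) => //; exists a.
Qed.

Lemma cogroup2_le_max K : cogroup2 K -> exists2 M, maximal_cogroup2 M & K `<=` M.
Proof.
move=> cK; pose P (J : set X) := J = set0 \/ (cogroup2 J /\ K `<=` J).
have [|M [PM maxM]] := @Zorn_bigcup _ P.
  move=> C CP totC.
  have [C0|[J CJ J0]] : (forall J, C J -> J = set0) \/ exists2 J, C J & J !=set0.
    have [|nJ] := pselect (exists2 J, C J & J !=set0); first by right.
    left=> J CJ; apply: contrapT => /eqP/set0P J0; by apply: nJ; exists J.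
    by left; rewrite bigcup0.
  have CP' L y : C L -> L y -> cogroup2 L /\ K `<=` L.
    by move=> /CP[->|].
  have [_ KJ] : cogroup2 J /\ K `<=` J by case: J0 => y; exact: CP'.
  right; split; last by move=> x /KJ Jx; exists J.
  have sup L M : C L -> C M -> exists2 U, C U & L `<=` U /\ M `<=` U.
    by move=> CL CM; have [LM|ML] := totC _ _ CL CM; [exists M => //; split|exists L => //; split].
  apply/cogroup2P; split.
  - by case: J0 => y Jy; exists y; exists J.
  - move=> a b c [L CL La] [M CM Mb] [U CU Uc].
    have [V CV [LV MV]] := sup _ _ CL CM; have [W CW [VW UW]] := sup _ _ CV CU.
    have Wa := VW _ (LV _ La); exists W => //.
    have [/cogroup2P[_ W3 _ _] _] := CP' _ _ CW Wa.
    by apply: W3; [|exact/VW/MV|exact: UW].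
  - move=> a [L CL La]; exists L => //.
    by have [/cogroup2P[_ _ LV _] _] := CP' _ _ CL La; exact: LV.
  - move=> a b [L CL La] [M CM Mb] [U CU Uab].
    have [V CV [LV MV]] := sup _ _ CL CM; have [W CW [VW UW]] := sup _ _ CV CU.
    have Wa := VW _ (LV _ La).
    have [/cogroup2P[_ _ _ W2] _] := CP' _ _ CW Wa.
    exact: (W2 _ _ Wa (VW _ (MV _ Mb)) (UW _ Uab)).
have [cM KM] : cogroup2 M /\ K `<=` M.
  case: PM => // M0; exfalso; apply: (maxM K); last by right; split.
  rewrite M0; split=> //; case: cK => [[y Ky] _] /(_ y Ky) //.
exists M => //; split=> // L cL ML; apply/seteqP; split=> //.
apply: contrapT => nLM; apply: (maxM L); first by split.
by right; split=> //; apply: subset_trans KM ML.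
Qed.

Lemma maximal_Fixm K A : maximal_cogroup2 K -> K `<=` Fixm A -> Fixm A = K.
Proof.
move=> [cK maxK] KA; apply: maxK => //; apply: cogroup2_Fixm.
by case: cK => [[x Kx] _]; exists x; exact: KA.
Qed.

Lemma exists_Fixm K : maximal_cogroup2 K -> exists A, Fixm A = K.
Proof.
move=> mK; have [A KA] := exists_Fixm_sup _ mK.1.
by exists A; exact: maximal_Fixm.
Qed.

(** The product NK is a 2-cogroup containing [K], so it equals [K]. Thus every nontrivial subgroup
    of X/KK contains the involution given by [K]. *)
Lemma maximal_cogroup2_absorb K N : maximal_cogroup2 K -> subgroup N ->
  (forall x, N x -> ~ K x) -> N `<=` setmul K K.
Proof.
move=> [cK maxK] [N1 NM NV] NK.
have /cogroup2P[[k Kk] K3 KV K2] := cK.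
have <- : setmul N K = K.
  apply: maxK; last by move=> x Kx; exists 1 => //; exists x => //; rewrite mul1g.
  apply/cogroup2P; split.
  - by exists k; exists 1 => //; exists k => //; rewrite mul1g.
  - move=> _ _ _ [n Nn [a Ka <-]] [m Nm [b Kb <-]] [l Nl [c Kc <-]].
    exists (n * m * l); first exact: (NM _ _ (NM _ _ Nn Nm) Nl).
    exists (a * b * c); first exact: K3.
    rewrite !mulgA; congr (_ * c); rewrite -!mulgA; congr (n * _).
    by rewrite !mulgA (abX a m) -!mulgA; congr (m * _); rewrite abX -mulgA (abX b).
  - move=> _ [n Nn [a Ka <-]]; exists n^-1; first exact: NV.
    by exists a^-1; [exact: KV|rewrite invgM abX].
  - move=> _ _ [n Nn [a Ka <-]] [m Nm [b Kb <-]] [l Nl [c Kc e]].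
    apply: (NK (n * m * l^-1)); first exact: (NM _ _ (NM _ _ Nn Nm) (NV _ Nl)).
    have -> : n * m * l^-1 = c * b^-1 * a^-1.
      have -> : n * m = l * c / b / a.
        by rewrite e !mulgA mulgK (mulACg n) mulgK.
      by rewrite -2!(mulgA l) (abX l) mulgK.
    by apply: K3 => //; exact: KV.
move=> x Nx; exists (x * k); first by exists x => //; exists k.
exists k^-1; last by rewrite mulgK.
by exists 1 => //; exists k^-1; [exact: KV|rewrite mul1g].
Qed.

End Cogroups.

(** * Minimal left ideals and maximal subgroups *)

Section MinimalIdeal.
Context {X : groupType} (abX : forall x y : X, x * y = y * x).
Implicit Types (x y z : X) (A B C : set X) (K N : set X) (e l F G : PPset X).
Implicit Types (a b c : set X -> set X).

Local Notation S := (superextension X).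
Local Notation op := (superext_op X).
Local Notation maxK := (@maximal_cogroup2 X).

(* A choice, for each maximal 2-cogroup K, of an orbit of twin sets. *)
Definition representatives b := forall K, maxK K -> Fixm (b K) = K.

Definition mtwin A := maxK (Fixm A).

Lemma exists_representatives : exists b, representatives b.
Proof.
have /choice[b bP] K : exists A, maxK K -> Fixm A = K.
  have [/(exists_Fixm abX)[A AK]|nK] := pselect (maxK K); first by exists A.
  by exists set0.
by exists b.
Qed.

Lemma max_twin K A : maxK K -> Fixm A = K -> twin A.
Proof. by rewrite /twin => mK ->; case: mK => -[]. Qed.

Lemma mtwin_twin A : mtwin A -> twin A.
Proof. by move=> mA; apply: (max_twin (Fixm A)). Qed.

Lemma mtwin_lshift x A : mtwin (x ** A) <-> mtwin A.
Proof. by rewrite /mtwin Fixm_lshift. Qed.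

Lemma Fixm_tr_max F A : S F -> mtwin A -> Fixm (tr F A) = Fixm A.
Proof. by move=> sF mA; apply: maximal_Fixm => //; exact: Fixm_tr. Qed.

Lemma lshift_Fixm_eq x y A B : twin A -> Fixm A `<=` Fixm B ->
  x ** A = y ** A -> x ** B = y ** B.
Proof.
move=> tA AB e; apply: (@lshift_inj _ x^-1); rewrite lshiftK -lshiftM.
by apply/esym; apply: (stab_Fixm A) => //; rewrite lshiftM -e lshiftK.
Qed.

Lemma superextension_ext_max (psi : set X -> set X) :
    (forall A, mtwin A -> Fixm (psi A) = Fixm A) ->
    (forall x A, mtwin A -> psi (x ** A) = x ** psi A) ->
  exists2 F, S F & forall A, mtwin A -> tr F A = psi A.
Proof.
move=> psiF psiM.
have [A tA|x A B PAB /mtwin_lshift mA|F [sF FP _]] :=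
    superextension_ext abX (fun A B => mtwin A -> B = psi A).
- have [mA|nA] := pselect (mtwin A); first by exists (psi A) => //; rewrite psiF.
  by exists A.
- by rewrite psiM// PAB.
- by exists F => // A mA; apply: FP => //; exact: mtwin_twin.
Qed.

(** Distinct [K] give distinct orbits of [b K], so these sets can be moved independently; [b K] and
    [c K] have the same stabilizer, which makes the move consistent along an orbit. *)
Lemma superextension_move b c : representatives b -> representatives c ->
  exists2 F, S F & forall K, maxK K -> tr F (b K) = c K.
Proof.
move=> bP cP.
have [A tA|x A B PAB K y mK e|F [sF FP _]] := superextension_ext abX
    (fun A B => forall K x, maxK K -> A = x ** b K -> B = x ** c K).
- have [[K [x [mK ->]]]|nA] := pselect (exists K x, maxK K /\ A = x ** b K).
    exists (x ** c K); last by rewrite !Fixm_lshift// bP// cP.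
    move=> L y mL e; have KL : K = L.
      by rewrite -(bP K)// -(bP L)// -(Fixm_lshift abX x) e Fixm_lshift.
    rewrite -KL in e *; apply: lshift_Fixm_eq e; first by apply: (max_twin K) => //; exact: bP.
    by rewrite bP// cP.
  by exists A => // K x mK e; case: nA; exists K, x.
- apply: (@lshift_inj _ x^-1); rewrite lshiftK -lshiftM; apply: PAB => //.
  by rewrite lshiftM -e lshiftK.
- exists F => // K mK; rewrite (FP _ _ K 1) ?lshift1//.
  exact: max_twin (bP _ mK).
Qed.

Definition orbit_valued b e := forall A,
  [\/ tr e A = setT, tr e A = set0 |
      exists K x, maxK K /\ tr e A = x ** b K].

Lemma orbit_valued_mtwin b e A : S e -> representatives b -> orbit_valued b e ->
  mtwin A -> exists x, tr e A = x ** b (Fixm A).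
Proof.
move=> se bP eO mA; have tA := twin_tr _ _ se (mtwin_twin _ mA).
have [e1|e1|[K [x [mK e1]]]] := eO A.
- by rewrite e1 in tA; have := not_twinT tA.
- by rewrite e1 in tA; have := not_twin0 tA.
by exists x; rewrite -(Fixm_tr_max _ _ se mA) e1 Fixm_lshift// bP.
Qed.

(** Right multiplication by [e] retains only the values of [F] at the sets [b K]. These values are
    the coordinates on the left ideal generated by [e]. *)
Lemma op_eq b e F G : S F -> S G -> orbit_valued b e ->
  (forall K, maxK K -> tr F (b K) = tr G (b K)) -> op F e = op G e.
Proof.
move=> sF sG eP FG; apply: tr_inj => A; rewrite !tr_op.
have [->|->|[K [x [mK ->]]]] := eP A; rewrite ?trT ?tr0//.
by rewrite !tr_lshift FG.
Qed.

Definition collapsing b e :=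
  [/\ S e, representatives b, forall K, maxK K -> tr e (b K) = b K & orbit_valued b e].

(** A twin set outside the chosen orbits is sent to [b M], for a maximal 2-cogroup [M] above its
    own. *)
Lemma exists_collapsing b : representatives b -> exists e, collapsing b e.
Proof.
move=> bP; have [A tA|x A B [[K [y [mK ->]]] AB]|F [sF FP FN]] :=
  superextension_ext abX (fun A B => (exists K x, maxK K /\ B = x ** b K) /\
    ((exists K x, maxK K /\ A = x ** b K) -> B = A)).
- have [[K [x [mK ->]]]|nA] := pselect (exists K x, maxK K /\ A = x ** b K).
    by exists (x ** b K) => //; split=> //; exists K, x.
  have [M mM AM] := cogroup2_le_max abX _ (cogroup2_Fixm abX _ tA).
  exists (b M); last by rewrite bP.
  by split=> //; exists M, 1; rewrite lshift1.
- split; first by exists K, (x * y); rewrite lshiftM.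
  move=> [L [z [mL e]]]; congr (_ ** _); apply: AB; exists L, (x^-1 * z).
  by rewrite lshiftM -e lshiftK.
- exists F; split=> // [K mK|A].
    have [|_] := FP (b K); first by apply: (max_twin K) => //; exact: bP.
    by apply; exists K, 1; rewrite lshift1.
  have [tA|/FN[]] := pselect (twin A); [|by constructor 1|by constructor 2].
  by constructor 3; exact: (FP A tA).1.
Qed.

Lemma collapsing_idem b e : collapsing b e -> op e e = e.
Proof.
move=> [se bP eb eO]; apply: tr_inj => A; rewrite tr_op.
have [->|->|[K [x [mK ->]]]] := eO A; rewrite ?trT ?tr0//.
by rewrite tr_lshift eb.
Qed.

(** [l] moves each [b K] to a twin set with the same 2-cogroup, and [y] moves it back. This
    cancellation is the source of minimality and of inverses. *)
Lemma collapsing_linv b e l : collapsing b e -> S l ->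
  exists2 y, S y & op y (op l e) = e.
Proof.
move=> [se bP eb eO] sl.
have [|//|y sy yP] := superextension_move (fun K => tr l (b K)) b.
  by move=> K mK; rewrite Fixm_tr_max ?bP// /mtwin bP.
exists y => //; rewrite superext_opA -[RHS](collapsing_idem b)//.
apply: op_eq eO _ => //; first exact: superextension_op.
by move=> K mK; rewrite tr_op yP// eb.
Qed.

Lemma left_ideal_principal e : S e -> is_left_ideal op S [set op s e | s in S].
Proof.
move=> se; split=> [_ [s ss <-]||s _ ss [t st <-]].
- exact: superextension_op.
- by exists (op e e), e.
- by exists (op s t); [exact: superextension_op|rewrite superext_opA].
Qed.

Lemma minimal_left_idealE (L : set (PPset X)) e :
  minimal_left_ideal op S L -> L e -> L = [set op s e | s in S].
Proof.
move=> [[LS _ Lop] minL] Le; apply/esym/minL.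
  exact: left_ideal_principal (LS _ Le).
by move=> _ [s ss <-]; exact: Lop.
Qed.

Lemma collapsing_minimal b e (x : PPset X) : collapsing b e -> S x ->
  minimal_left_ideal op S [set op s (op e x) | s in S].
Proof.
move=> ce sx; have [se bP eb eO] := ce; split.
  exact: left_ideal_principal (superextension_op _ _ se sx).
move=> J [JS [j Jj] Jop] JL; apply/seteqP; split=> //.
have [s ss sj] := JL _ Jj.
have [y sy ye] := collapsing_linv _ _ s ce ss.
move=> _ [t st <-]; rewrite -ye -!superext_opA sj.
by rewrite superext_opA; apply: Jop => //; exact: superextension_op.
Qed.

Lemma minimal_idealE b e : collapsing b e ->
  minimal_ideal op S = [set z | exists2 y, S y & exists2 x, S x & z = op (op y e) x].
Proof.
move=> ce; have [se bP eb eO] := ce; apply/seteqP; split=> [z|_ [y sy [x sx ->]]].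
  apply; split=> //; split=> [|s _ ss [y sy [x sx ->]]]; last first.
    exists y => //; exists (op x s); last by rewrite superext_opA.
    exact: superextension_op.
  split=> [_ [y sy [x sx ->]]||s _ ss [y sy [x sx ->]]].
  - by do 2?apply: superextension_op.
  - by exists (op (op e e) e), e => //; exists e.
  - exists (op s y); first exact: superextension_op.
    by exists x => //; rewrite !superext_opA.
move=> I [[[IS [i Ii] SI] IrS] _].
have [w sw we] := collapsing_linv _ _ i ce (IS _ Ii).
by rewrite -we; apply/IrS/SI/SI/IrS.
Qed.

(** For an idempotent [e] this is the monoid eSe. It contains every subgroup around [e], so it is
    the maximal one as soon as it is a group. *)
Definition local_group e := [set l | [/\ S l, op e l = l & op l e = l]].

Lemma local_groupP b e i : collapsing b e -> S i ->
    minimal_ideal op S i -> op i i = i ->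
  exists inv, is_group_with op (local_group i) i inv.
Proof.
move=> ce si; rewrite (minimal_idealE _ _ ce) => -[y sy [x sx iE]] ii.
have [se _ _ _] := ce.
have linv l : local_group i l -> exists2 m, local_group i m & op m l = i.
  move=> [sl il li]; have [w sw we] := collapsing_linv _ _ (op l y) ce (superextension_op _ _ sl sy).
  (* Since i = yex and w(ly)e = e, the product ml = iywl = iywli = iyw(lye)x reduces to iyex = i. *)
  pose m := op (op i (op y w)) i.
  have sm : S m by do ?apply: superextension_op.
  exists m; first by split=> //; rewrite /m ?superext_opA ?ii// -superext_opA ii.
  rewrite /m -superext_opA il -{1}li {2}iE -!superext_opA (superext_opA _ e).
  rewrite -!superext_opA in we *.
  have -> : op w (op l (op y (op e x))) = op e x.
    by rewrite -[in RHS]we -!superext_opA.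
  by rewrite (superext_opA y) -iE.
have Gi : local_group i i by [].
have Gop l m : local_group i l -> local_group i m -> local_group i (op l m).
  move=> [sl il li] [sm im mi]; split; first exact: superextension_op.
    by rewrite superext_opA il.
  by rewrite -superext_opA mi.
have /choice[inv invP] l : exists m, local_group i l -> local_group i m /\ op m l = i.
  have [/linv[m Gm ml]|nl] := pselect (local_group i l); first by exists m.
  by exists l.
exists inv; split=> // [l m n _ _ _|l [_ il li]|l Gl].
- exact: superext_opA.
- by [].
- have [Gm ml] := invP _ Gl; split=> //; have [Gn nm] := invP _ Gm.
  have lE : l = inv (inv l).
    have [_ _ ni] := Gn; have [_ il _] := Gl.
    by rewrite -[LHS]il -nm -superext_opA ml ni.
  by rewrite {1}lE.
Qed.

Lemma maximal_subgroupP b e (G : set (PPset X)) : collapsing b e ->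
  maximal_subgroup_in op S (minimal_ideal op S) G <->
  exists i, [/\ S i, minimal_ideal op S i, op i i = i & G = local_group i].
Proof.
move=> ce; split=> [[i [mi ii [GS [u [inv Ginv]]] Gi maxG]]|[i [si mi ii ->]]].
  have [Gu Gop GA G1 GV] := Ginv.
  have si : S i := GS _ Gi; exists i; split=> //.
  apply/seteqP; split=> [l Gl|]; last first.
    apply: maxG; last by [].
    by split=> [l []//|]; exists i; exact: local_groupP ce si mi ii.
  have ui : u = i.
    have [Gm mi1 _] := GV _ Gi.
    by rewrite -mi1 -{2}ii GA// mi1 (G1 _ Gi).1.
  by have [ul lu] := G1 _ Gl; rewrite ui in ul lu; split=> //; exact: GS.
exists i; split=> //; first by split=> [l []//|]; exists i; exact: local_groupP ce si mi ii.
move=> H [HS [u [inv [Hu Hop HA H1 HV]]]] Hi l Hl.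
have ui : u = i.
  have [Hm mi1 _] := HV _ Hi.
  by rewrite -mi1 -{2}ii HA// mi1 (H1 _ Hi).1.
by have [ul lu] := H1 _ Hl; rewrite ui in ul lu; split=> //; exact: HS.
Qed.

End MinimalIdeal.

(** * Topology *)

Section Topology.

Lemma cvg_prod (U I : Type) (K : I -> topologicalType) (F : set_system U)
    (g : U -> prod_topology K) (l : prod_topology K) : Filter F ->
  (forall i, (fun u => g u i) @ F --> l i) -> g @ F --> l.
Proof.
move=> FF gl; apply/cvg_sup => i A [B [[C oC <-] Cl] BA].
apply: (filterS (P := g @^-1` ((fun f : prod_topology K => f i) @^-1` C))).
  by move=> v; exact: BA.
by apply: gl; apply: open_nbhs_nbhs.
Qed.

Lemma continuous_prod (U : topologicalType) (I : Type) (K : I -> topologicalType)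
    (g : U -> prod_topology K) :
  (forall i, continuous (fun u => g u i)) -> continuous g.
Proof. by move=> gc u; apply: cvg_prod => i; exact: gc. Qed.

(* A continuous bijection from a compact space onto a subset of a Hausdorff
   space is a homeomorphism, so only the inverse map has to be examined. *)
Lemma compact_top_isomorphic (T U : topologicalType) (opT : T -> T -> T)
    (opU : U -> U -> U) (A : set T) (g : U -> T) (u0 : U) :
    hausdorff_space T -> compact [set: U] -> continuous g -> injective g ->
    range g = A -> (forall u v, g (opU u v) = opT (g u) (g v)) ->
  top_isomorphic opT A opU.
Proof.
move=> hT cU gc ginj rg gM.
have /choice[f fP] t : exists u, A t -> g u = t.
  have [|nA] := pselect (A t); last by exists u0.
  by rewrite -rg => -[u _ <-]; exists u.
have gA u : A (g u) by rewrite -rg; exists u.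
exists f, g; split=> //.
- by split=> // u; apply: ginj; exact: fP.
- by move=> a b Aa Ab; apply: ginj; rewrite gM !fP// -(fP a)// -(fP b)// -gM.
- apply/continuous_closedP => C cC; apply/closed_subspaceP; exists (g @` C).
    apply: compact_closed => //; apply: continuous_compact.
      exact: continuous_subspaceT.
    by apply: (subclosed_compact cC cU).
  apply/seteqP; split=> t [].
    move=> [u Cu <-] _; split=> //; rewrite /from_subspace /preimage /=.
    by suff -> : f (g u) = u by []; exact/ginj/fP.
  by move=> Cft At; split=> //; exists (f t) => //; exact: fP.
Qed.

Lemma compact_cover_compact (T : topologicalType) (t : T) (A : set T) :
  compact A -> cover_compact A.
Proof.
pose T' : ptopologicalType := HB.pack T (isPointed.Build T t).
by move=> cA; have : @compact T' A by []; rewrite compact_cover.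
Qed.

Lemma PPset_hausdorff (X : groupType) : hausdorff_space (PPset X).
Proof.
by apply: (@hausdorff_product _ (fun _ : set X => bool)) => _; exact: discrete_hausdorff.
Qed.

Lemma PPset_eval_continuous (X : groupType) (A : set X) :
  continuous (fun F : PPset X => F A).
Proof. exact: (@proj_continuous _ (fun _ : set X => bool)). Qed.

Context (X : groupType) (D : nat -> choiceType).

Lemma qprod_compact :
  (forall k, finite_set [set: D k.+1]) -> compact [set: qprod X D].
Proof.
move=> fD; rewrite (_ : setT = [set f : qprod X D | forall k, [set: _] (f k)])//; last first.
  by apply/seteqP; split.
apply: (@tychonoff _ (fun k : nat => prod_topology (fun _ : q_classes X (C2 k.+1) =>
    discrete_topology (D k.+1))) (fun=> setT)) => k.
rewrite (_ : setT = [set f : prod_topology (fun _ : q_classes X (C2 k.+1) =>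
    discrete_topology (D k.+1)) | forall c, setT (f c)]); last first.
  by apply/seteqP; split.
apply: (@tychonoff _ (fun _ : q_classes X (C2 k.+1) => discrete_topology (D k.+1))
  (fun=> setT)) => c.
by apply: finite_compact; exact: fD.
Qed.

Lemma qprod_eval_continuous k (c : q_classes X (C2 k.+1)) :
  continuous (fun u : qprod X D => u k c).
Proof.
move=> u; apply: (@continuous_comp _ _ _ (proj k : qprod X D -> _) (proj c)).
  exact: (@proj_continuous _ (fun k : nat => prod_topology
    (fun _ : q_classes X (C2 k.+1) => discrete_topology (D k.+1)))).
exact: (@proj_continuous _ (fun _ : q_classes X (C2 k.+1) =>
  discrete_topology (D k.+1))).
Qed.

(** Continuity of the parametrizations of ideals reduces to this, each evaluation reading a single
    coordinate. *)
Lemma qprod_discrete_continuous (U : topologicalType) k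
    (c : q_classes X (C2 k.+1)) (h : D k.+1 -> U) :
  continuous (fun u : qprod X D => h (u k c)).
Proof.
move=> u; apply: (@cvg_comp _ _ _ (fun u : qprod X D => u k c : discrete_topology (D k.+1)) h).
  exact: qprod_eval_continuous.
by move=> V /nbhs_singleton hV; apply/principal_filterP.
Qed.

End Topology.

(** * Characters of the quotient by a maximal 2-cogroup *)

Section RootsOfUnity.
Import GRing.Theory Num.Theory.
Local Open Scope ring_scope.

(* [zeta n] has order 2 ^ n.+1, not 2 ^ n. *)
Definition zeta (n : nat) : CC := iter n (@sqrtc _) (- 1).

Lemma zetaS n : zeta n.+1 ^+ 2 = zeta n.
Proof. exact: sqr_sqrtc. Qed.

Lemma zeta_lift n m : zeta (n + m) ^+ (2 ^ m) = zeta n.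
Proof.
elim: m => [|m IHm]; first by rewrite addn0 expr1.
by rewrite addnS expnS exprM zetaS.
Qed.

Lemma zeta_le n m i : (n <= m)%N -> zeta n ^+ i = zeta m ^+ (2 ^ (m - n) * i).
Proof. by move=> nm; rewrite -(zeta_lift n (m - n)) subnKC// exprM. Qed.

Lemma zetaN1 n : zeta n ^+ (2 ^ n) = - 1.
Proof. exact: (zeta_lift 0). Qed.

Lemma CC_N1_neq1 : (-1 : CC) != 1.
Proof. by rewrite eqNr oner_eq0. Qed.

Lemma zeta_prim n : (2 ^ n.+1).-primitive_root (zeta n).
Proof.
have z1 : zeta n ^+ (2 ^ n.+1) = 1 by rewrite expnSr exprM zetaN1 sqrrN expr1n.
have gt0 : (0 < 2 ^ n.+1)%N by rewrite expn_gt0.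
have [m mp /dvdn_pfactor[//|j jn mE]] := prim_order_exists gt0 z1.
move: jn; rewrite leq_eqVlt => /predU1P[jn|]; first by rewrite -jn -mE.
rewrite ltnS => jn; have := CC_N1_neq1; rewrite -(zetaN1 n) => /eqP[].
by apply/eqP; rewrite -(prim_order_dvd mp) mE dvdn_exp2l.
Qed.

Lemma root2P n (z : CC) : z ^+ (2 ^ n.+1) = 1 ->
  exists2 i, (i < 2 ^ n.+1)%N & z = zeta n ^+ i.
Proof. by move=> /(prim_rootP (zeta_prim n))[i ->]; exists i. Qed.

Lemma C2ooP (z : CC) : C2oo z <-> exists n i, z = zeta n ^+ i.
Proof.
split=> [[[|k] []// _ /root2P[i _ ->]]|[n [i ->]]]; first by exists k, i.
exists n.+1; split=> //; rewrite -exprM mulnC exprM.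
by rewrite (prim_expr_order (zeta_prim n)) expr1n.
Qed.

Lemma C2oo_neq0 (z : CC) : C2oo z -> z != 0.
Proof.
move=> [k [_ zk]]; apply/eqP => z0; move: zk.
by move/eqP; rewrite z0 expr0n expn_eq0 /= eq_sym oner_eq0.
Qed.

Lemma C2_valX k (u : C2 k) i : val (u ^+ i)%g = val u ^+ i.
Proof. by elim: i => // i IHi; rewrite expgS exprS -IHi. Qed.

Lemma zetaC_subproof k : is_root2 k.+1 (zeta k).
Proof. by apply/eqP; exact: prim_expr_order (zeta_prim k). Qed.

Definition zetaC k : C2 k.+1 := Sub (zeta k) (zetaC_subproof k).

Lemma C2P k (u : C2 k.+1) :
  exists i : 'I_(2 ^ k.+1), u = (zetaC k ^+ i)%g.
Proof.
have /root2P[i ik ui] := eqP (valP u); exists (Ordinal ik).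
by apply: val_inj; rewrite C2_valX.
Qed.

Lemma zetaC_eq k i j :
  (zetaC k ^+ i)%g = (zetaC k ^+ j)%g <-> i = j %[mod 2 ^ k.+1].
Proof.
split=> [/(congr1 val)|/eqP].
  by rewrite !C2_valX => /eqP; rewrite (eq_prim_root_expr (zeta_prim k)) => /eqP.
by rewrite -(eq_prim_root_expr (zeta_prim k)) => /eqP h; apply: val_inj; rewrite !C2_valX.
Qed.

Lemma finite_C2 k : finite_set [set: C2 k.+1].
Proof.
have -> : [set: C2 k.+1] = [set (zetaC k ^+ i)%g | i in [set: 'I_(2 ^ k.+1)]].
  by apply/seteqP; split=> // u _; have [i ->] := C2P _ u; exists i.
exact/finite_image/finite_finset.
Qed.

End RootsOfUnity.

Lemma odd_part m : (0 < m)%N -> exists n q, m = (2 ^ n * q)%N /\ odd q.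
Proof.
move=> m0; exists (logn 2 m), (m %/ 2 ^ logn 2 m)%N.
have mE : m = (2 ^ logn 2 m * (m %/ 2 ^ logn 2 m))%N.
  by rewrite mulnC divnK// pfactor_dvdnn.
split=> //; rewrite -[odd _]negbK -dvdn2; apply/negP => /dvdnP[r qE].
have : (2 ^ (logn 2 m).+1 %| m)%N by rewrite {2}mE qE mulnC -mulnA -expnS dvdn_mull.
by rewrite pfactor_dvdn// ltnn.
Qed.

Section Characters.
Context {X : groupType} (abX : forall x y : X, x * y = y * x).
Implicit Types (x y z g : X) (K N : set X).

Variables (K : set X) (maxK : maximal_cogroup2 K).
Let N := setmul K K.
Let cK : cogroup2 K := maxK.1.

Let N1 : N 1. Proof. by have [] := setmul_subgroup abX _ cK. Qed.
Let NM {x y} : N x -> N y -> N (x * y).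
Proof. by have [_ h _] := setmul_subgroup abX _ cK; exact: h. Qed.
Let NV {x} : N x -> N x^-1.
Proof. by have [_ _ h] := setmul_subgroup abX _ cK; exact: h. Qed.
Let NX {x} n : N x -> N (x ^+ n).
Proof. by move=> Nx; elim: n => // n IHn; rewrite expgS; exact: NM. Qed.
Let KN {x y} : N x -> K y -> K (x * y).
Proof. exact: setmulKM. Qed.
Let KnN {x} : K x -> ~ N x.
Proof. exact: setmulK_disjoint. Qed.
Let KK {x y} : K x -> K y -> N (x * y).
Proof. by exists x => //; exists y. Qed.

(** By [maximal_cogroup2_absorb] the cyclic group generated by [y] meets [K]; inverting in [K] makes
    the exponent a natural number. *)
Lemma exists_expg_in_K y : ~ N y -> exists m, K (y ^+ m).
Proof.
move=> nNy; apply: contrapT => nK; apply: nNy.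
pose H : set X := [set z | exists i j, z = y ^+ i / y ^+ j].
have sub : H `<=` N.
  apply: (maximal_cogroup2_absorb abX _ _ maxK); last first.
    move=> _ [i [j ->]]; have [/subnK <-|/ltnW/subnK <-] := leqP j i.
      by rewrite expgnDr mulgK => h; apply: nK; eexists; exact: h.
    have /cogroup2P[//|_ _ KV _] := cK => /KV.
    by rewrite expgnDr invgM invgK mulgK => h; apply: nK; eexists; exact: h.
  split=> [|_ _ [i [j ->]] [l [m ->]]|_ [i [j ->]]].
  - by exists 0, 0; rewrite mulgV.
  - exists (i + l)%N, (j + m)%N; rewrite !expgnDr invgM.
    by rewrite -!mulgA; congr (_ * _); rewrite abX -mulgA.
  - by exists j, i; rewrite invgM invgK.
by apply: sub; exists 1%N, 0; rewrite expg1 invg1 mulg1.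
Qed.

(** Let the exponent be 2^n q with [q] odd, and w = y^(2^n). If w^2 were outside [N], some w^(2j)
    would lie in [K], and so would its odd power w^(2jq), which as an even power of w^q lies in [N].
    Hence w agrees with w^q modulo [N]. *)
Lemma exists_exp2_in_K y : ~ N y -> exists n, K (y ^+ (2 ^ n)).
Proof.
move=> nNy; have [m Km] := exists_expg_in_K y nNy.
have m0 : (0 < m)%N by case: m Km => // /KnN; rewrite expg0.
have [n [q [mE oq]]] := odd_part m m0; exists n; set w := y ^+ (2 ^ n).
have Kwq : K (w ^+ q) by rewrite -expgnA -mE.
have Nw2 : N (w ^+ 2).
  apply: contrapT => /exists_expg_in_K[j]; rewrite -expgnA => Kj.
  have := cogroup2X abX _ _ q cK Kj; rewrite oq -expgnA mulnC expgnA => /KnN; apply.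
  by have := cogroup2X abX _ _ (2 * j)%N cK Kwq; rewrite oddM.
have := Kwq; rewrite -(odd_double_half q) oq add1n -mul2n expgS expgnA => h.
rewrite -[w](mulgK ((w ^+ 2) ^+ q./2)) abX; apply: KN => //; exact/NV/NX.
Qed.

Lemma expg_in_N k g i : K (g ^+ (2 ^ k)) -> N (g ^+ i) <-> (2 ^ k.+1 %| i)%N.
Proof.
move=> Kg; split=> [Ni|/dvdnP[q ->]].
  have [->|i0] := posnP i; first exact: dvdn0.
  have [n [q [iE oq]]] := odd_part i i0.
  have [nk|kn] := leqP n k; last by rewrite iE dvdn_mulr// dvdn_exp2l.
  have := cogroup2X abX _ _ q cK Kg; rewrite oq => /KnN[].
  rewrite -expgnA -(subnK nk) expnD -mulnA -iE mulnC expgnA; exact: NX.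
rewrite mulnC expnSr -mulnA expgnA.
by have := cogroup2X abX _ _ (2 * q) cK Kg; rewrite oddM.
Qed.

Lemma expg_cong k g i j : K (g ^+ (2 ^ k)) ->
  N (g ^+ i / g ^+ j) <-> i = j %[mod 2 ^ k.+1].
Proof.
have le a b : K (g ^+ (2 ^ k)) -> (b <= a)%N ->
    N (g ^+ a / g ^+ b) <-> a = b %[mod 2 ^ k.+1].
  move=> Kg ba; rewrite -expgnFr//; apply: (iff_trans (expg_in_N _ _ _ Kg)).
  by rewrite -eqn_mod_dvd//; split=> /eqP.
move=> Kg; have [/le//|/ltnW/le h] := leqP j i; first exact.
have NE : N (g ^+ i / g ^+ j) <-> N (g ^+ j / g ^+ i).
  by split=> /NV; rewrite invgM invgK.
by apply: (iff_trans NE); apply: (iff_trans (h Kg)); split.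
Qed.

(* The character is given by the graph y ~ g n ^+ i |-> zeta n ^+ i, for
   generators [g n] of a chain of cyclic subgroups of X / N that exhausts it;
   [D] selects the terms of the chain that exist. *)
Lemma character_of_chain (D : nat -> Prop) (g : nat -> X) :
    (forall n, D n -> K (g n ^+ (2 ^ n))) ->
    (forall n m, D n -> D m -> (n <= m)%N -> N (g n / g m ^+ (2 ^ (m - n)))) ->
    (forall y, exists n i, D n /\ N (y / g n ^+ i)) ->
  exists f : X -> CC, [/\ forall x y, f (x * y) = (f x * f y)%R,
    forall x, f x = 1%R <-> N x &
    forall z : CC, range f z <-> exists n i, D n /\ z = (zeta n ^+ i)%R].
Proof.
move=> Kg gL gX.
have trN x y z : N (x / y) -> N (y / z) -> N (x / z).
  by move=> h1 h2; have := NM h1 h2; rewrite mulgA mulgVK.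
have symN x y : N (x / y) -> N (y / x) by move=> /NV; rewrite invgM invgK.
have MN x x' y y' : N (x / x') -> N (y / y') -> N (x * y / (x' * y')).
  move=> h1 h2; have := NM h1 h2; congr N.
  rewrite (abX x') invgM -!mulgA; congr (_ * _); rewrite !mulgA; congr (_ * _).
  exact: abX.
have XN x y n : N (x / y) -> N (x ^+ n / y ^+ n).
  by move=> /(NX n); rewrite expgnFl//; exact: abX.
have lift n m y i : D n -> D m -> (n <= m)%N -> N (y / g n ^+ i) ->
    N (y / g m ^+ (2 ^ (m - n) * i)).
  by move=> Dn Dm nm /trN; apply; rewrite expgnA; exact/XN/gL.
have /choice[f fP] y : exists z : CC, exists n i,
    [/\ D n, N (y / g n ^+ i) & z = (zeta n ^+ i)%R].
  by have [n [i [Dn h]]] := gX y; exists (zeta n ^+ i)%R, n, i.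
have fE n y i : D n -> N (y / g n ^+ i) -> f y = (zeta n ^+ i)%R.
  move=> Dn h; have [m [j [Dm h' ->]]] := fP y.
  wlog nm : n m i j Dn h Dm h' / (n <= m)%N => [W|].
    have [/W|/ltnW/W W'] := leqP n m; first exact.
    by apply/esym/W'.
  rewrite (zeta_le _ _ _ nm); apply/eqP; rewrite (eq_prim_root_expr (zeta_prim m)).
  apply/eqP/(expg_cong _ _ _ _ (Kg _ Dm)); apply: trN (symN _ _ h') _.
  exact: lift nm h.
exists f; split=> [x y|x|z].
- have [n [i [Dn h _]]] := fP x; have [m [j [Dm h' _]]] := fP y.
  wlog nm : n m i j x y Dn h Dm h' / (n <= m)%N => [W|].
    have [|/ltnW] := leqP n m; first exact: W Dn h Dm h'.
    by rewrite abX GRing.mulrC; exact: W Dm h' Dn h.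
  have hx := lift _ _ _ _ Dn Dm nm h.
  rewrite (fE _ _ _ Dm hx) (fE _ _ _ Dm h') -GRing.exprD; apply: fE => //.
  by rewrite expgnDr; exact: MN.
- have [n [i [Dn h fx]]] := fP x; rewrite fx.
  have z1 : (zeta n ^+ i = 1)%R <-> N (g n ^+ i).
    apply: iff_trans (iff_sym (expg_in_N _ _ _ (Kg _ Dn))).
    by rewrite (prim_order_dvd (zeta_prim n)); split=> /eqP.
  split=> [/z1 h'|h']; first by have := NM h h'; rewrite mulgVK.
  by apply/z1; have := NM (NV h) h'; rewrite invgM invgK mulgVK.
- split=> [[x _ <-]|[n [i [Dn ->]]]].
    by have [n [i [Dn _ ->]]] := fP x; exists n, i.
  by exists (g n ^+ i) => //; apply: fE => //; rewrite mulgV.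
Qed.

(** X/N has one involution, so if y^(2^j) is outside [N] it agrees with g^(2^k) modulo [N]. Dividing
    [y] by g^(2^(k-j)) then lowers its order. *)
Lemma cyclic_in_quotient k j g y : K (g ^+ (2 ^ k)) -> N (y ^+ (2 ^ j)) ->
  (j <= k.+1)%N -> exists i, N (y / g ^+ i).
Proof.
move=> Kg; elim: j y => [|j IHj] y Ny jk.
  by exists 0; rewrite invg1 mulg1.
have [/IHj|nN] := pselect (N (y ^+ (2 ^ j))); first by apply; exact: ltnW.
have Ku : K (y ^+ (2 ^ j)).
  have [n] := exists_exp2_in_K _ nN; case: n => [|n]; first by rewrite expg1.
  by rewrite -expgnA -expnD addnS -addSn expnD expgnA => /KnN[]; exact: NX.
have [|i Ni] := IHj (y / g ^+ (2 ^ (k - j))) _ (ltnW jk).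
  rewrite expgnFl; last exact: abX.
  rewrite -expgnA -expnD subnK//; apply: KK => //.
  by have /cogroup2P[//|_ _ KV _] := cK; exact: KV.
exists (i + 2 ^ (k - j))%N; move: Ni; congr N.
by rewrite expgnDr invgM mulgA.
Qed.

(** [Q n] provides an element of order 2^(n+1) in X/N. If such orders are unbounded, successive
    square roots form a chain exhausting X/N; otherwise an element of the largest order generates
    X/N. *)
Lemma maximal_cogroup2_quotient :
  (exists k (chi : X -> C2 k.+1), [/\ forall x y, chi (x * y) = chi x * chi y,
     forall x, chi x = 1 <-> N x & range chi = setT]) \/
  (exists f : X -> CC, (forall x y, f (x * y) = (f x * f y)%R) /\ range f = C2oo).
Proof.
pose Q n := exists g, K (g ^+ (2 ^ n)).
have QS n : Q n.+1 -> Q n.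
  by move=> [g Kg]; exists (g ^+ 2); rewrite -expgnA -expnS.
have Q0 : Q 0 by have /cogroup2P[//|[g Kg] _ _ _] := cK; exists g; rewrite expg1.
have [Qall|nQ] := pselect (forall n, Q n); [right|left].
  have step n x : exists y, K (x ^+ (2 ^ n)) ->
      K (y ^+ (2 ^ n.+1)) /\ N (x / y ^+ 2).
    have [Kx|nK] := pselect (K (x ^+ (2 ^ n))); last by exists x.
    have [y Ky] := Qall n.+1.
    have Ky2 : K ((y ^+ 2) ^+ (2 ^ n)) by rewrite -expgnA -expnS.
    have Nx : N (x ^+ (2 ^ n.+1)).
      by rewrite expnSr expgnA; exact: (cogroup2X abX _ _ 2 cK Kx).
    (* Modulo [N], [x] and y^2 have the same order, so [x] is some (y^2)^i and y^i is its square
       root. *)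
    have [i Ni] := cyclic_in_quotient _ _ _ _ Ky2 Nx (leqnn _).
    exists (y ^+ i); split; last by rewrite expgnAC.
    rewrite expnS expgnA expgnAC.
    have := KN (NX (2 ^ n) (NV Ni)) Kx.
    rewrite invgM invgK expgnFl; last exact: abX.
    by rewrite mulgVK (expgnAC y 2 i) (expgnAC _ 2).
  pose s n := projT1 (choice (step n)).
  have sP n x := projT2 (choice (step n)) x.
  have [g0 Kg0] := Q0.
  pose g := fix g n := if n is m.+1 then s m (g m) else g0.
  have Kg n : K (g n ^+ (2 ^ n)).
    by elim: n => // n IHn; have [] := sP n (g n) IHn.
  have gL n m : (n <= m)%N -> N (g n / g m ^+ (2 ^ (m - n))).
    elim: m => [|m IHm]; first by rewrite leqn0 => /eqP ->; rewrite mulgV.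
    rewrite leq_eqVlt => /predU1P[->|]; first by rewrite subnn mulgV.
    rewrite ltnS => nm; rewrite subSn// expnS.
    have [_ h] := sP m (g m) (Kg m).
    have := NM (IHm nm) (NX (2 ^ (m - n)) h); rewrite expgnFl; last exact: abX.
    by rewrite mulgA mulgVK -expgnA.
  have [||y|f [fM _ fr]] := character_of_chain (fun=> True) g.
  - by [].
  - by move=> n m _ _; exact: gL.
  - have [Ny|/exists_exp2_in_K[n Kn]] := pselect (N y).
      by exists 0, 0; split=> //; rewrite invg1 mulg1.
    have Ny : N (y ^+ (2 ^ n.+1)).
      by rewrite expnSr expgnA; exact: (cogroup2X abX _ _ 2 cK Kn).
    by have [i Ni] := cyclic_in_quotient _ _ _ _ (Kg n) Ny (leqnn _); exists n, i.
  exists f; split=> //; apply/seteqP; split=> z.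
    by move=> /fr[n [i [_ ->]]]; apply/C2ooP; exists n, i.
  by move=> /C2ooP[n [i ->]]; apply/fr; exists n, i.
have [k [g Kg] Qk] : exists2 k, Q k & forall n, Q n -> (n <= k)%N.
  have [n nQn] : exists n, `[< ~ Q n >].
    apply: contrapT => h; apply: nQ => n; apply: contrapT => nQn; apply: h.
    by exists n; exact/asboolP.
  have exn : exists n, `[< ~ Q n >] by exists n.
  case: (ex_minnP exn) => m /asboolP nQm mmin.
  case: m nQm mmin => [//|m] nQm mmin; exists m.
    by apply: contrapT => /asboolP/mmin; rewrite ltnn.
  move=> i Qi; rewrite -ltnS ltnNge; apply/negP => mi; apply: nQm.
  elim: i Qi mi => [|i IHi]; first by rewrite ltn0.
  by rewrite leq_eqVlt => Qi /predU1P[->//|]; apply: IHi; exact: QS.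
have [n ->//|n m -> -> _|y|f [fM f1 fr]] := character_of_chain (fun n => n = k) (fun=> g).
- by rewrite subnn mulgV.
- have [Ny|/exists_exp2_in_K[n Kn]] := pselect (N y).
    by exists k, 0; split=> //; rewrite invg1 mulg1.
  have Ny : N (y ^+ (2 ^ n.+1)).
    by rewrite expnSr expgnA; exact: (cogroup2X abX _ _ 2 cK Kn).
  have nk : (n.+1 <= k.+1)%N by rewrite ltnS; apply: Qk; exists y.
  by have [i Ni] := cyclic_in_quotient _ _ _ _ Kg Ny nk; exists k, i.
have fk x : is_root2 k.+1 (f x).
  have [n [i [-> ->]]] := (fr (f x)).1 (ex_intro2 _ _ x I erefl).
  rewrite /is_root2 -GRing.exprM mulnC GRing.exprM (prim_expr_order (zeta_prim k)).
  by rewrite GRing.expr1n.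
exists k, (fun x => Sub (f x) (fk x) : C2 k.+1); split=> [x y|x|].
- by apply: val_inj; rewrite /= fM.
- by rewrite -f1; split=> [/(congr1 val)|h]; [|apply: val_inj].
- apply/seteqP; split=> // u _; have [i ui] := C2P _ u.
  have /fr[x _ fx] : exists n j, n = k /\ (zeta k ^+ i)%R = (zeta n ^+ j)%R by exists k, i.
  by exists x => //; apply: val_inj; rewrite ui C2_valX.
Qed.

End Characters.

(** * Groups with a quasicyclic quotient *)

Section Quasicyclic.
Context {X : groupType} (abX : forall x y : X, x * y = y * x).
Implicit Types (x y z : X) (A B C : set X) (K N : set X) (e l F G : PPset X).
Context (f : X -> CC) (fM : forall x y, f (x * y) = (f x * f y)%R)
  (fR : range f = C2oo).

Local Notation S := (superextension X).
Local Notation op := (superext_op X).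
Local Notation maxK := (@maximal_cogroup2 X).

Let K0 : set X := [set x | f x = (- 1)%R].

Let f_C2oo x : C2oo (f x). Proof. by rewrite -fR; exists x. Qed.

Let f_neq0 x : f x != 0%R. Proof. exact/C2oo_neq0/f_C2oo. Qed.

Let f1 : f 1 = 1%R.
Proof.
apply: (GRing.mulfI (f_neq0 1)); by rewrite -fM mulg1 GRing.mulr1.
Qed.

Let fV x : f x^-1 = (f x)^-1%R.
Proof.
by apply: (GRing.mulfI (f_neq0 x)); rewrite -fM mulgV f1 GRing.mulfV.
Qed.

Let fX x n : f (x ^+ n) = (f x ^+ n)%R.
Proof. by elim: n => // n IHn; rewrite expgS fM IHn GRing.exprS. Qed.

Let f_surj n i : exists x, f x = (zeta n ^+ i)%R.
Proof.
have : range f (zeta n ^+ i)%R by rewrite fR; apply/C2ooP; exists n, i.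
by move=> [x _ <-]; exists x.
Qed.

Let f_exp2 x : exists k, (f x ^+ (2 ^ k))%R = 1%R.
Proof. by have [k [_ h]] := f_C2oo x; exists k. Qed.

Let f_zeta x : exists n j, (j < 2 ^ n.+1)%N /\ f x = (zeta n ^+ j)%R.
Proof.
have [n [j fx]] : exists n j, f x = (zeta n ^+ j)%R by exact/C2ooP/f_C2oo.
exists n, (j %% 2 ^ n.+1)%N; rewrite ltn_mod expn_gt0; split=> //.
by rewrite (prim_expr_mod (zeta_prim n)).
Qed.

Lemma exp2_root (z : CC) k : (z ^+ (2 ^ k))%R = 1%R ->
  z = 1%R \/ exists m, (z ^+ (2 ^ m))%R = (- 1)%R.
Proof.
elim: k => [|k IHk]; first by rewrite GRing.expr1; left.
rewrite expnSr GRing.exprM => /eqP; rewrite GRing.sqrf_eq1 => /orP[] /eqP //.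
by right; exists k.
Qed.

Lemma cogroup2_kernel : cogroup2 K0.
Proof.
apply/(cogroup2P abX); split.
- by have [x fx] := f_surj 0 1; exists x.
- by move=> a b c; rewrite /K0 /= !fM => -> -> ->; rewrite GRing.mulrNN !GRing.mul1r.
- by move=> a; rewrite /K0 /= fV => ->; rewrite GRing.invrN1.
- move=> a b; rewrite /K0 /= fM => -> ->; rewrite GRing.mulrNN GRing.mul1r => /esym.
  exact/eqP/CC_N1_neq1.
Qed.

(** Let [y] lie in a larger 2-cogroup with f y ≠ -1. If f y = 1, then [y] is a product of two
    elements of [K0]; otherwise an even power of [y] lies in [K0]. A 2-cogroup allows neither. *)
Lemma maximal_kernel : maxK K0.
Proof.
split=> [|K' cK' KK']; first exact: cogroup2_kernel.
apply/seteqP; split=> // y K'y; have /(cogroup2P abX)[_ _ _ K2] := cK'.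
have [k /exp2_root[fy|[[|m]]]] := f_exp2 y.
- have [[x Kx] _] := cogroup2_kernel; exfalso.
  apply: (K2 x (x^-1 * y)); [exact: KK'| |by rewrite mulVKg].
  by apply: KK'; rewrite /K0 /= fM fV fy Kx GRing.invrN1 GRing.mulr1.
- by rewrite GRing.expr1.
- rewrite -fX => /KK' K'ym; exfalso.
  have := cogroup2X abX _ _ (2 ^ m.+1) cK' K'y; rewrite expnS oddM /= -expnS.
  exact: setmulK_disjoint K'ym.
Qed.

Lemma lshift_kernel A x y : Fixm A = K0 -> x ** A = y ** A <-> f x = f y.
Proof.
move=> AK; have tA : twin A by rewrite /twin AK; case: cogroup2_kernel.
have [k Kk] := tA; have fk : f k = (- 1)%R by rewrite AK in Kk.
have e1 z : z ** A = A <-> f z = 1%R.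
  have -> : (f z = 1%R) = Fixm A (z * k).
    rewrite AK /K0 /= fM fk GRing.mulrN1; apply/propext; split=> [->//|/GRing.oppr_inj//].
  rewrite /Fixm /= lshiftM Kk lshiftC; split=> [->//|/(congr1 setC)].
  by rewrite !setCK.
have -> : (f x = f y) = (f (y^-1 * x) = 1%R).
  rewrite fM fV; apply/propext; split=> [->|/(congr1 ( *%R (f y)))].
    exact: GRing.mulVf.
  by rewrite GRing.mulrA GRing.mulfV// GRing.mul1r GRing.mulr1.
rewrite -e1 lshiftM; split=> [->|/(congr1 (Defs.lshift y))]; first exact: lshiftK.
by rewrite lshiftVK.
Qed.

Lemma f_not_bounded (N : nat) : ~ forall x, (f x ^+ (2 ^ N))%R = 1%R.
Proof.
move=> h; have [x fx] := f_surj N 1; have := h x.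
by rewrite fx GRing.expr1 zetaN1; apply/eqP/CC_N1_neq1.
Qed.

Lemma f_enum : exists nu : nat -> X, forall x, exists n, f x = f (nu n).
Proof.
have /choice[nu nuP] n : exists x, forall p, unpickle n = Some p ->
    f x = (zeta p.1 ^+ p.2)%R.
  case: (unpickle n : option (nat * nat)) => [[m i]|]; last by exists 1.
  by have [x fx] := f_surj m i; exists x => _ [<-].
exists nu => x; have [n [j [_ fx]]] := f_zeta x.
by exists (pickle (n, j)); rewrite (nuP _ (n, j)) ?pickleK.
Qed.

(* Baire category argument: the orbit of A is countable, and it is homogeneous,
   so if it were compact it would be finite. *)
Lemma orbit_not_compact (G : set (PPset X)) A : Fixm A = K0 ->
  (forall l, G l -> exists x, tr l A = x ** A) ->
  (forall x, exists2 l, G l & tr l A = x ** A) -> ~ compact G.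
Proof.
move=> AK Gorb orbG cG0.
have cG : cover_compact G := compact_cover_compact (PPset X) (fun=> true) _ cG0.
(* [p] lists finitely many prescribed membership bits; [V p] is the clopen set of systems whose
   value at [A] has these bits. *)
pose W (p : seq (X * bool)) B := all (fun q => `[< B q.1 >] == q.2) p.
pose V p := [set l | W p (tr l A)].
have clV p : open (V p) /\ open (~` V p).
  elim: p => [|[x b] p [oV oCV]].
    rewrite (_ : V [::] = setT); first by rewrite setCT; split; [exact: openT|exact: open0].
    by apply/seteqP; split.
  have VE : V ((x, b) :: p) = (fun l : PPset X => l (x^-1 ** A)) @^-1` [set b] `&` V p.
    apply/seteqP; split=> l; rewrite /V /= /W /= -/(W p (tr l A)) /tr /= asboolb.
      by move=> /andP[/eqP -> ->].
    by move=> [-> ->]; rewrite eqxx.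
  have oE (c : set bool) : open ((fun l : PPset X => l (x^-1 ** A)) @^-1` c).
    apply: open_comp; last exact: discrete_open.
    by move=> l _; exact: PPset_eval_continuous.
  split; rewrite VE; first by apply: openI => //; exact: oE.
  by rewrite setCI preimage_setC; apply: openU => //; exact: oE.
(* If a pattern isolates one point of the orbit, its shifts isolate all points, and a finite
   subcover leaves only finitely many. If no point is isolated, patterns can be refined so as to
   avoid the points one by one. *)
have [[p [h0 [Wh0 ph0]]]|nisol] := pselect (exists p h0, W p (h0 ** A) /\
    forall h, W p (h ** A) -> f h = f h0).
  pose sh y := [seq (y * q.1, q.2) | q <- p].
  have WE y h : W (sh y) (h ** A) = W p ((y^-1 * h) ** A).
    rewrite /W all_map; apply: eq_all => -[x b] /=.
    by rewrite lshiftM [y^-1 ** _]lshiftE /= invgK.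
  have [|l Gl|D _ GD] := cG X setT (V \o sh).
  - by move=> y _; have [] := clV (sh y).
  - have [h lh] := Gorb _ Gl; exists (h * h0^-1) => //.
    by rewrite /V /= lh WE invgM invgK mulgVK.
  have [k kP] := choice f_exp2.
  (* The exponent 2^N kills the finitely many values of [f] left by the subcover. *)
  pose N := \max_(y <- finmap.enum_fset D) k (y * h0)%g.
  apply: (f_not_bounded N) => x; have [l Gl lx] := orbG x.
  have [y /= Dy] := GD _ Gl; rewrite /V /= lx WE => /ph0 fx.
  have -> : f x = f (y * h0) by rewrite fM -fx fM fV GRing.mulrA GRing.mulfV// GRing.mul1r.
  have kN : (k (y * h0)%g <= N)%N.
    exact: (@leq_bigmax_seq _ _ xpredT (fun y => k (y * h0)%g) y Dy isT).
  by rewrite -(subnKC kN) expnD GRing.exprM kP GRing.expr1n.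
have [nu nuP] := f_enum.
have step n p : exists q, (exists h, W p (h ** A)) ->
    (exists h, W (q :: p) (h ** A)) /\ ~ W (q :: p) (nu n ** A).
  have [[h Wh]|nh] := pselect (exists h, W p (h ** A)); last by exists (1, true).
  have [h' Wh' hh'] : exists2 h', W p (h' ** A) & f h' <> f h.
    apply: contrapT => nh'; apply: nisol; exists p, h; split=> // h' Wh'.
    by apply: contrapT => ne; apply: nh'; exists h'.
  have [x xP] : exists x, ~ ((h' ** A) x <-> (h ** A) x).
    apply: contrapT => nx; apply: hh'; apply/(lshift_kernel A) => //.
    apply/seteqP; split=> x Ax; apply: contrapT => nAx; apply: nx; exists x;
      by move=> [h1 h2]; auto.
  (* The shifts by [h] and [h'] differ at [x], so one of them has there the bit opposite to that of
     the shift by [nu n]. *)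
  exists (x, ~~ `[< (nu n ** A) x >]) => _; split; last first.
    by move=> /andP[/eqP] /=; case: `[< _ >].
  have [Ahx|nAhx] := pselect ((h ** A) x <-> ~ (nu n ** A) x).
    exists h; rewrite /W /= -/(W p (h ** A)) Wh andbT -asbool_neg.
    exact/eqP/asbool_equiv_eq.
  exists h'; rewrite /W /= -/(W p (h' ** A)) Wh' andbT -asbool_neg.
  apply/eqP/asbool_equiv_eq; split=> [h'x nx|nnx].
    by apply: nAhx; split=> // hx; exfalso; apply: xP; split.
  apply: contrapT => nh'x; apply: nAhx; split=> // _; apply: contrapT => nhx.
  by apply: xP; split.
have /choice[s sP] n : exists s, forall p, (exists h, W p (h ** A)) ->
    (exists h, W (s p :: p) (h ** A)) /\ ~ W (s p :: p) (nu n ** A).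
  by have [s sP] := choice (step n); exists s.
pose P := fix P n := if n is m.+1 then s m (P m) :: P m else [::].
have P_ne n : exists h, W (P n) (h ** A).
  elim: n => [|n IHn]; first by exists 1.
  by have [] := sP n (P n) IHn.
have P_mono n m l : (n <= m)%N -> V (P m) l -> V (P n) l.
  elim: m => [|m IHm]; first by rewrite leqn0 => /eqP ->.
  rewrite leq_eqVlt => /predU1P[->//|nm] /andP[_]; exact: IHm.
have [|l Gl|D _ GD] := cG nat setT (fun n => ~` V (P n)).
- by move=> n _; have [] := clV (P n).
- have [h lh] := Gorb _ Gl; have [n fn] := nuP h; exists n.+1 => //.
  have hn : h ** A = nu n ** A by exact/(lshift_kernel A).
  by have := (sP n (P n) (P_ne n)).2; rewrite -hn -lh.
have [h Wh] := P_ne (\max_(n <- finmap.enum_fset D) n); have [l Gl lh] := orbG h.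
have [n /= Dn] := GD _ Gl; apply; apply: (P_mono _ (\max_(n <- finmap.enum_fset D) n)).
  exact: (@leq_bigmax_seq _ _ xpredT id n Dn isT).
by rewrite /V /= lh.
Qed.

(** The principal ultrafilter at [x]; under [tr] it acts as the shift by the inverse of [x]. *)
Definition point x : PPset X := fun A => `[< A x >].

Lemma superextension_point x : S (point x).
Proof.
apply/superextensionP; split=> [A B AB /asboolP Ax|A]; first by apply/asboolP/AB.
by rewrite /point -asbool_neg.
Qed.

Lemma tr_point x A : tr (point x^-1) A = x ** A.
Proof.
rewrite lshiftE; apply/seteqP; split=> y; rewrite /tr /point /= lshiftE /= invgK abX.
  by move=> /asboolP.
by move=> Ay; apply/asboolP.
Qed.

Lemma maximal_subgroup_not_compact (G : set (PPset X)) :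
  maximal_subgroup_in op S (minimal_ideal op S) G -> ~ compact G.
Proof.
have [b bP] := @exists_representatives X abX; have [e ce] := exists_collapsing abX _ bP.
have [se _ eb eO] := ce.
move=> /(maximal_subgroupP abX b e G ce)[i [si mi ii ->]].
have [y sy [x sx iE]] : [set z | exists2 y, S y & exists2 x, S x & z = op (op y e) x] i.
  by rewrite -(minimal_idealE abX _ _ ce).
have mK0 := maximal_kernel; pose C := tr y (b K0).
have iorb B : Fixm B = K0 -> exists z, tr i B = z ** C.
  move=> BK; have mB : mtwin B by rewrite /mtwin BK.
  have mxB : mtwin (tr x B) by rewrite /mtwin Fixm_tr_max.
  have [z ez] := orbit_valued_mtwin abX _ _ _ se bP eO mxB.
  exists z; rewrite iE !tr_op ez tr_lshift; congr (_ ** tr y (b _)).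
  by rewrite Fixm_tr_max.
have mbK : mtwin (b K0) by rewrite /mtwin bP.
have FiK : Fixm (tr i (b K0)) = K0 by rewrite Fixm_tr_max// bP.
have [z0 iA] := iorb _ (bP _ mK0).
have trii B : tr i (tr i B) = tr i B by rewrite -tr_op ii.
apply: (orbit_not_compact _ (tr i (b K0))) => // [l [sl il li]|z].
  have : Fixm (tr l (tr i (b K0))) = K0 by rewrite Fixm_tr_max /mtwin ?FiK.
  move=> /iorb[z]; rewrite -tr_op il => ->; exists (z * z0^-1).
  by rewrite iA lshiftM lshiftK.
(* Shifts commute with [tr i], so the shifted [i] stays in the local group and realizes the given
   [z]. *)
exists (op (point z^-1) i); last by rewrite tr_op tr_point trii.
split.
- exact: superextension_op (superextension_point _) si.
- by apply: tr_inj => B; rewrite !tr_op !tr_point tr_lshift trii.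
- by rewrite -superext_opA ii.
Qed.

(* The preimage of the half-open upper half circle: its translates generate on
   the orbit a Sorgenfrey-like topology, for which inversion is discontinuous. *)
Definition arc : set X :=
  [set x | exists n j, (j < 2 ^ n)%N /\ f x = (zeta n ^+ j)%R].

(** Two expressions of f x are compared at a common level [M], where exponents below 2^(M+1) are
    unique. In [bound], [c] is 0 for the half circle and 1 for the full circle. *)
Lemma arcP x n j : (j < 2 ^ n.+1)%N -> f x = (zeta n ^+ j)%R ->
  arc x <-> (j < 2 ^ n)%N.
Proof.
move=> jn fx; split=> [[m [i [im fx']]]|jn']; last by exists n, j.
pose M := maxn n m.
have bound k r c : (k <= M)%N -> (2 ^ (M - k) * r < 2 ^ (M + c))%N = (r < 2 ^ (k + c))%N.
  move=> kM; rewrite -[in RHS](ltn_pmul2l (expn_gt0 2 (M - k) : (0 < 2 ^ (M - k))%N)).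
  by rewrite -expnD addnA subnK.
have nM : (n <= M)%N by exact: leq_maxl.
have mM : (m <= M)%N by exact: leq_maxr.
have e : (2 ^ (M - n) * j = 2 ^ (M - m) * i)%N.
  have : (zeta M ^+ (2 ^ (M - n) * j) == zeta M ^+ (2 ^ (M - m) * i))%R.
    by rewrite -!zeta_le// -fx -fx'.
  rewrite (eq_prim_root_expr (zeta_prim M)) !modn_small; first by move=> /eqP.
    by rewrite -[M.+1]addn1 bound// addn1 expnS mul2n -addnn ltn_addr.
  by rewrite -[M.+1]addn1 bound// addn1.
have := bound m i 0 mM; have := bound n j 0 nM; rewrite !addn0 e => <- ->.
exact: im.
Qed.

Lemma Fixm_arc : Fixm arc = K0.
Proof.
apply: (maximal_Fixm abX); first exact: maximal_kernel.
move=> k Kk; rewrite /Fixm /= lshiftE; apply/seteqP.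
have kx x : arc (k^-1 * x) <-> ~ arc x.
  have [n [j [jn fx]]] := f_zeta x; rewrite (arcP _ _ _ jn fx).
  have fk : f (k^-1 * x) = (- f x)%R.
    by rewrite fM fV Kk GRing.invrN1 GRing.mulN1r.
  have [jn'|nj] := ltnP j (2 ^ n).
    rewrite (arcP _ n (2 ^ n + j)); last 2 first.
    - by rewrite expnS mul2n -addnn ltn_add2l.
    - by rewrite fk fx GRing.exprD zetaN1 GRing.mulN1r.
    by rewrite -[X in (_ < X)%N]addn0 ltn_add2l ltn0; split.
  rewrite (arcP _ n (j - 2 ^ n)); last 2 first.
  - exact: leq_ltn_trans (leq_subr _ _) jn.
  - by rewrite fk fx -{1}(subnKC nj) GRing.exprD zetaN1 GRing.mulN1r GRing.opprK.
  by rewrite ltn_subLR// addnn -mul2n -expnS jn; split.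
by split=> x /kx.
Qed.

Lemma maximal_subgroup_not_topological : exists G : set (PPset X),
  maximal_subgroup_in op S (minimal_ideal op S) G /\ ~ topological_group op G.
Proof.
have [b0 b0P] := @exists_representatives X abX.
pose b K := if `[< K = K0 >] then arc else b0 K.
have bK0 : b K0 = arc by rewrite /b asboolT.
have bP : representatives b.
  move=> K mK; rewrite /b; case: asboolP => [->|_]; first exact: Fixm_arc.
  exact: b0P.
have [e ce] := exists_collapsing abX _ bP; have [se _ eb eO] := ce.
have ee := collapsing_idem _ _ ce.
have tree A : tr e (tr e A) = tr e A by rewrite -tr_op ee.
exists (local_group e); split.
  apply/(maximal_subgroupP abX b e _ ce); exists e; split=> //.
  rewrite (minimal_idealE abX _ _ ce).
  by exists e => //; exists e => //; rewrite ee ee.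
(* Only twin sets with 2-cogroup [K0] are shifted, so that convergence to [e] has to be checked on
   the orbit of [arc] alone. *)
pose c x A := if `[< Fixm A = K0 >] then x else 1.
have /choice[F FP] x : exists F, S F /\ forall A, mtwin A -> tr F A = c x A ** A.
  have [A mA|y A mA|F sF FP] := superextension_ext_max abX (fun A => c x A ** A).
  - exact: Fixm_lshift.
  - by rewrite /c Fixm_lshift// lshiftCA.
  - by exists F.
pose th x := op (F x) e.
have trth x A : tr (th x) A = c x (tr e A) ** tr e A.
  rewrite tr_op; have [->|->|[K [z [mK ->]]]] := eO A.
  - by rewrite trT ?lshiftT//; exact: (FP x).1.
  - by rewrite tr0 ?lshift0//; exact: (FP x).1.
  - by apply: (FP x).2; apply/(mtwin_lshift abX); rewrite /mtwin bP.
have thM x y : op (th x) (th y) = th (x * y).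
  apply: tr_inj => A; rewrite tr_op !trth tr_lshift tree -lshiftM.
  by rewrite /c Fixm_lshift//; case: asboolP; rewrite ?mulg1.
have th1 : th 1 = e.
  by apply: tr_inj => A; rewrite trth /c; case: ifP => _; rewrite lshift1.
have thG x : local_group e (th x).
  split; first exact: superextension_op (FP x).1 se.
    by rewrite -th1 thM mul1g.
  by rewrite -th1 thM mulg1.
have eG : local_group e e by [].
move=> [u [inv [[Gu _ _ G1 GV] _ cinv]]].
have ue : u = e.
  by have [h _] := G1 _ eG; have [_ _ h'] := Gu; rewrite -h'.
subst u.
have inve : inv e = e.
  by have [[_ _ h] h' _] := GV _ eG; rewrite -h.
have invth x : inv (th x) = th x^-1.
  have [[_ _ h] h' _] := GV _ (thG x).
  rewrite -h -th1 -(mulgV x) -thM superext_opA h'.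
  by rewrite -th1 thM mul1g.
have /choice[y yP] n : exists y, f y = zeta n.
  by have [y fy] := f_surj n 1; exists y; rewrite fy GRing.expr1.
(* Membership of 1 in the shifted arc amounts to that of z^-1 (y n) in [arc]. A small enough
   positive rotation carries no given point across an end of the half-open arc. *)
have thcvg : (fun n => th (y n)^-1) @ \oo --> e.
  apply: cvg_prod => A; apply/discrete_cvg.
  have : \forall n \near \oo, th (y n)^-1 A = e A; last by apply: filterS.
  have trA l : is_true (l A) = tr l A 1 by rewrite tr1.
  have [eAK|eAK] := pselect (Fixm (tr e A) = K0); last first.
    apply: nearW => n; apply/idP/idP; rewrite !trA trth /c asboolF// lshift1//.
  have [z eA] : exists z, tr e A = z ** arc.
    have meA : mtwin (tr e A) by rewrite /mtwin eAK; exact: maximal_kernel.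
    have [z] := orbit_valued_mtwin abX _ _ _ se bP eO meA.
    by rewrite tree eAK bK0; exists z.
  have [m [j [jm fz]]] := f_zeta z^-1.
  exists m.+1 => // n /= mn; have mn' := ltnW mn.
  suff arcE : arc (z^-1 * y n) <-> arc z^-1.
    have thA : tr (th (y n)^-1) A = ((y n)^-1 * z) ** arc.
      by rewrite trth /c asboolT// eA lshiftM.
    apply/idP/idP; rewrite !trA thA eA !lshiftE /= !mulg1 invgM invgK; by move/arcE.
  (* A point of level [m] has at level [n] an exponent divisible by 2^(n-m), which is at least 2;
     the added 1 does not reach the next multiple. *)
  have bound r q : (2 ^ (n - m) * r + 1 < 2 ^ (n + q))%N = (r < 2 ^ (m + q))%N.
    have -> : (2 ^ (n + q) = 2 ^ (n - m) * 2 ^ (m + q))%N.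
      by rewrite -expnD addnA subnK.
    have gt0 : (0 < 2 ^ (n - m))%N by rewrite expn_gt0.
    apply/idP/idP => h.
      by rewrite -(ltn_pmul2l gt0); apply: leq_ltn_trans h; exact: leq_addr.
    apply: (@leq_trans (2 ^ (n - m) * r.+1)%N); last by rewrite leq_pmul2l.
    by rewrite mulnSr ltn_add2l -[1%N]/(2 ^ 0)%N ltn_exp2l// subn_gt0.
  rewrite (arcP _ _ _ jm fz) (arcP _ n (2 ^ (n - m) * j + 1)).
  - by have := bound j 0; rewrite !addn0 => ->.
  - by rewrite -[n.+1]addn1 bound addn1.
  - by rewrite fM fz yP (zeta_le m n)// -GRing.exprSr addn1.
have nW : nbhs (inv e) [set l : PPset X | l arc = true].
  have ea : e arc.
    rewrite -tr1 -bK0 eb ?bK0; last exact: maximal_kernel.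
    by exists 0, 0; rewrite f1 GRing.expr0.
  rewrite inve; apply: (PPset_eval_continuous _ arc _ [set true]).
  by rewrite /= ea; exact: discrete_set1.
have : within (local_group e) (nbhs e) [set l | inv l arc = true].
  by rewrite nbhs_subspace_in//; exact: (cinv e _ nW).
move=> /thcvg[N _ NP].
have := NP N.+1 (leqnSn N) (thG _); rewrite /= invth invgK => thy.
have : tr (th (y N.+1)) arc 1 by rewrite tr1.
rewrite trth -bK0 eb ?bK0; last exact: maximal_kernel.
rewrite /c asboolT ?Fixm_arc// lshiftE /= mulg1.
(* The opposite rotation takes 1 to the largest exponent, outside [arc], although 1 itself lies in
   [arc]. *)
have zV : f (y N.+1)^-1 = (zeta N.+1 ^+ (2 ^ N.+2).-1)%R.
  apply: (GRing.mulfI (f_neq0 (y N.+1))); rewrite -fM mulgV f1 yP -GRing.exprS.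
  by rewrite prednK ?expn_gt0// (prim_expr_order (zeta_prim N.+1)).
rewrite (arcP _ _ _ _ zV); last by rewrite prednK ?expn_gt0.
rewrite ltnNge -ltnS prednK ?expn_gt0// => /negP; apply.
by rewrite ltn_exp2l.
Qed.

End Quasicyclic.

(** * Transport of continuity and compactness along the isomorphisms *)

Section TopologicalGroups.

Lemma top_isomorphic_group (T U : topologicalType) (opT : T -> T -> T)
    (opU : U -> U -> U) (A : set T) (u : U) (inv : U -> U) :
    associative opU -> left_id u opU -> right_id u opU ->
    left_inverse u inv opU -> right_inverse u inv opU ->
    continuous (fun p : U * U => opU p.1 p.2) -> continuous inv ->
    (forall a b, A a -> A b -> A (opT a b)) ->
  top_isomorphic opT A opU -> topological_group opT A.
Proof.
move=> opA op1u opu1 opVu opuV opc invc AM [f [g [[gA gK] fK fM fc gc]]].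
have gM a b : A a -> A b -> opT a b = g (opU (f a) (f b)).
  by move=> Aa Ab; rewrite -fM// fK//; exact: AM.
have fcA a V : A a -> nbhs (f a) V -> nbhs a [set b | A b -> V (f b)].
  by move=> Aa; move/subspace_continuousP: fc => /(_ a Aa); exact.
exists (g u), (fun a => g (inv (f a))); split.
- split=> // [a b c Aa Ab Ac|a Aa|a Aa].
  + have Aab := AM _ _ Aa Ab; have Abc := AM _ _ Ab Ac.
    by rewrite gM// fM// gM// fM// opA.
  + by rewrite !gM// gK op1u opu1 fK.
  + by rewrite !gM// gK opVu opuV.
- apply: (@subspace_eq_continuous _ _ _ (fun p => g (opU (f p.1) (f p.2)))).
    by move=> [a b]; rewrite inE /from_subspace => -[/= Aa Ab]; rewrite gM.
  apply/subspace_continuousP => -[a b] [/= Aa Ab] V nV.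
  have /gc nV1 := nV; have [[V1 V2] [/= n1 n2] V12] := opc (f a, f b) _ nV1.
  exists ([set a | A a -> V1 (f a)], [set b | A b -> V2 (f b)]).
    by split; exact: fcA.
  by move=> [a' b'] [/= h1 h2] [/= Aa' Ab']; apply: (V12 (f a', f b')); split; auto.
- apply/subspace_continuousP => a Aa V /gc nV.
  exact: (fcA a _ Aa (invc _ _ nV)).
Qed.

Lemma qprod_C2_group (X : groupType) (T : topologicalType) (opT : T -> T -> T)
    (A : set T) :
    (forall a b, A a -> A b -> A (opT a b)) ->
    top_isomorphic opT A (@qprod_mul X (fun k => C2 k) (fun k => *%g)) ->
  topological_group opT A.
Proof.
pose one : qprod X (fun k => C2 k) := fun k c => 1.
pose inv (u : qprod X (fun k => C2 k)) : qprod X (fun k => C2 k) := fun k c => (u k c)^-1.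
have ext (u v : qprod X (fun k => C2 k)) : (forall k c, u k c = v k c) -> u = v.
  by move=> uv; apply: functional_extensionality_dep => k; apply: funext => c.
move=> AM; apply: (top_isomorphic_group _ _ _ _ _ one inv) => //.
- by move=> u v w; apply: ext => k c; exact: mulgA.
- by move=> u; apply: ext => k c; exact: mul1g.
- by move=> u; apply: ext => k c; exact: mulg1.
- by move=> u; apply: ext => k c; exact: mulVg.
- by move=> u; apply: ext => k c; exact: mulgV.
- apply: continuous_prod => k; apply: continuous_prod => c [u v].
  have nu := qprod_eval_continuous X (fun k => C2 k) k c u _ (discrete_set1 _).
  have nv := qprod_eval_continuous X (fun k => C2 k) k c v _ (discrete_set1 _).
  move=> V /nbhs_singleton /= Vuv; 
  exists ([set w | w k c = u k c], [set w | w k c = v k c]).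
    by split; [exact: nu|exact: nv].
  by move=> [u' v'] [/= hu hv]; rewrite /preimage /= /qprod_mul /= hu hv.
- apply: continuous_prod => k; apply: continuous_prod => c.
  exact: (qprod_discrete_continuous X (fun k => C2 k) (discrete_topology (C2 k.+1)) k c
    (fun x => x^-1)).
Qed.

End TopologicalGroups.

Section CompactMaximalSubgroup.
Context {X : groupType} (abX : forall x y : X, x * y = y * x).
Context (D : nat -> choiceType) (opD : forall k, D k -> D k -> D k).

Local Notation S := (superextension X).
Local Notation op := (superext_op X).

Lemma closed_qprod (P : forall k, q_classes X (C2 k.+1) -> set (D k.+1)) :
  closed [set u : qprod X D | forall k c, P k c (u k c)].
Proof.
have -> : [set u : qprod X D | forall k c, P k c (u k c)] =
    \bigcap_k \bigcap_c [set u : qprod X D | P k c (u k c)].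
  by apply/seteqP; split=> u uP; [move=> k _ c _; exact: uP|move=> k c; exact: uP].
apply: closed_bigI => k _; apply: closed_bigI => c _.
apply: (@closed_comp _ (discrete_topology (D k.+1)) (fun u : qprod X D => u k c) (P k c)).
  by move=> u _; exact: qprod_eval_continuous.
exact: discrete_closed.
Qed.

(** If h is the inverse of pxp in the local group of [p], then hxhx = h(pxp)hx = phx = hx. *)
Lemma exists_idempotent_in_left_ideal (L : set (PPset X)) :
  is_left_ideal op S L ->
  exists e, [/\ L e, op e e = e & minimal_ideal op S e].
Proof.
move=> [LS [x Lx] Lop]; have sx := LS _ Lx.
have [b bP] := @exists_representatives X abX.
have [p cp] := exists_collapsing abX _ bP; have [sp _ _ _] := cp.
have pp := collapsing_idem _ _ cp.
have mip : minimal_ideal op S p.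
  by rewrite (minimal_idealE abX _ _ cp); exists p => //; exists p => //; rewrite !pp.
have [inv [_ _ _ G1 GV]] := local_groupP abX _ _ _ cp sp mip pp.
pose g := op (op p x) p.
have Gg : local_group p g.
  split; first by do ?apply: superextension_op.
    by rewrite /g !superext_opA pp.
  by rewrite /g -superext_opA pp.
have [[si pi ip] ig gi] := GV _ Gg; set h := inv g in si pi ip ig gi.
exists (op h x); split; first exact: Lop.
  rewrite -{2}pi -{1}ip -!superext_opA (superext_opA p x) (superext_opA _ p).
  by rewrite (superext_opA h (op _ _)) -/g ig superext_opA pi.
rewrite (minimal_idealE abX _ _ cp).
by exists h => //; exists x => //; rewrite ip.
Qed.

(** The equations of the local group of [e] hold coordinatewise in the product, where they cut out a
    closed, hence compact, set [E]. *)
Lemma exists_compact_maximal_subgroup (L : set (PPset X)) :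
    (forall k, finite_set [set: D k.+1]) -> is_left_ideal op S L ->
    top_isomorphic op L (@qprod_mul X D opD) ->
  exists G, maximal_subgroup_in op S (minimal_ideal op S) G /\ compact G.
Proof.
move=> fD lL [f [g [[gL gK] fK fM fc gc]]]; have [LS _ Lop] := lL.
have [e [Le ee mie]] := exists_idempotent_in_left_ideal _ lL.
have [b bP] := @exists_representatives X abX.
have [p cp] := exists_collapsing abX _ bP.
exists (local_group e); split.
  by apply/(maximal_subgroupP abX b p _ cp); exists e; split=> //; exact: LS.
pose E := [set u : qprod X D | forall k c,
  opD _ (f e k c) (u k c) = u k c /\ opD _ (u k c) (f e k c) = u k c].
have -> : local_group e = g @` E.
  apply/seteqP; split=> [l [sl el le]|_ [u Eu <-]].
    have Ll : L l by rewrite -le; exact: Lop.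
    exists (f l); last exact: fK.
    move=> k c; have := fM _ _ Le Ll; have := fM _ _ Ll Le; rewrite el le.
    by move=> /(congr1 (fun u => u k c)) /= h1 /(congr1 (fun u => u k c)) /= h2.
  split; first exact: LS.
    rewrite -[LHS]fK; last exact: Lop (LS _ Le) (gL u).
    rewrite fM// gK; congr g; apply: functional_extensionality_dep => k.
    by apply: funext => c; exact: (Eu k c).1.
  rewrite -[LHS]fK; last exact: Lop (LS _ (gL u)) Le.
  rewrite fM// gK; congr g; apply: functional_extensionality_dep => k.
  by apply: funext => c; exact: (Eu k c).2.
apply: continuous_compact; first exact: continuous_subspaceT.
apply: (subclosed_compact _ (qprod_compact X D fD)) => //.
exact: closed_qprod (fun k c => [set v | opD _ (f e k c) v = v /\ opD _ v (f e k c) = v]).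
Qed.

End CompactMaximalSubgroup.

Lemma lshift_Fixm_stab (X : groupType) (abX : forall x y : X, x * y = y * x)
    (K A : set X) (x : X) : cogroup2 K -> Fixm A = K ->
  x ** A = A <-> setmul K K x.
Proof.
move=> cK AK; have [[k Kk] _] := cK.
have Ak : k ** A = ~` A by rewrite -[_ = _]/(Fixm A k) AK.
rewrite (setmulKP abX _ _ _ cK Kk) -AK /Fixm /= lshiftM Ak lshiftC.
by split=> [->//|/(congr1 setC)]; rewrite !setCK.
Qed.

(** * Groups without quasicyclic quotients *)

Section Coordinates.
Context {X : groupType} (abX : forall x y : X, x * y = y * x).
Context (K : set X) (maxK : maximal_cogroup2 K) (k : nat) (chi : X -> C2 k.+1).
Context (chiM : forall x y, chi (x * y) = chi x * chi y).
Context (chi1 : forall x, chi x = 1 <-> setmul K K x) (chiR : range chi = setT).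
Implicit Types (x y z g : X) (A B : set X).

Let cK : cogroup2 K := maxK.1.

Let chiV x : chi x^-1 = (chi x)^-1.
Proof.
apply/esym/mulg1_eq; rewrite -chiM mulgV; apply/chi1.
by have [] := setmul_subgroup abX _ cK.
Qed.

Let chiX x n : chi (x ^+ n) = chi x ^+ n.
Proof.
elim: n => [|n IHn]; first by apply/chi1; have [] := setmul_subgroup abX _ cK.
by rewrite !expgS chiM IHn.
Qed.

Lemma lshift_chi A x y : Fixm A = K -> x ** A = y ** A <-> chi x = chi y.
Proof.
move=> AK; have -> : (x ** A = y ** A) = ((y^-1 * x) ** A = A).
  apply/propext; rewrite lshiftM; split=> [->|{2}<-]; first exact: lshiftK.
  by rewrite lshiftVK.
rewrite (lshift_Fixm_stab _ abX K) // -chi1 chiM chiV.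
by split=> [/mulg1_eq|->]; rewrite ?invgK ?mulVg.
Qed.

(** Elements of [K] have order two modulo KK, and the exponent 2^k gives the only involution of the
    cyclic group. *)
Lemma chi_cogroup x : K x <-> chi x = zetaC k ^+ (2 ^ k).
Proof.
have KE y : K y -> chi y = zetaC k ^+ (2 ^ k).
  move=> Ky; have [[i im] /= yi] := C2P _ (chi y).
  have y2 : chi y ^+ 2 = 1 by rewrite -chiX; apply/chi1; exists y => //; exists y.
  have y1 : chi y <> 1 by move=> /chi1; exact: setmulK_disjoint.
  have : zetaC k ^+ (i * 2) = zetaC k ^+ 0 by rewrite expgnA -yi y2.
  move=> /zetaC_eq/eqP; rewrite mod0n expnSr => /eqP h.
  have /dvdnP[q iq] : (2 ^ k %| i)%N.
    by rewrite -(@dvdn_pmul2r 2)// /dvdn h.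
  have q2 : (q < 2)%N.
    by move: im; rewrite iq expnS ltn_pmul2r// expn_gt0.
  clear im; case: q q2 iq => [|[|//]] _ iq; last by rewrite yi iq mul1n.
  by case: y1; rewrite yi iq mul0n.
split=> [/KE//|xz]; have [[y Ky] _] := cK.
have : setmul K K (x / y) by apply/chi1; rewrite chiM chiV xz (KE _ Ky) mulgV.
by move=> /(setmulKM abX _ _ _ cK)/(_ Ky); rewrite mulgVK.
Qed.

Let m := (2 ^ k)%N.
Let m_gt0 : (0 < m)%N. Proof. by rewrite expn_gt0. Qed.
Let mE : (2 ^ k.+1 = m + m)%N. Proof. by rewrite expnS mul2n addnn. Qed.

(* A twin set with [Fixm A = K] is coded by a function on Z / 2m that changes
   its value under the shift by m, hence by its values on 0, .., m - 1. *)
Let ext (v : m.-tuple bool) (i : nat) : bool := nth false v (i %% m) (+) odd (i %/ m).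

Let extD v i : ext v (i + m) = ~~ ext v i.
Proof. by rewrite /ext modnDr divnDr// divnn m_gt0 addn1 /= addbN. Qed.

Let ext_mod v i j : i = j %[mod 2 ^ k.+1] -> ext v i = ext v j.
Proof.
have h q r : ext v (r + q * (2 ^ k.+1)) = ext v r.
  elim: q => [|q IHq]; first by rewrite mul0n addn0.
  by rewrite mulSnr mE !addnA !extD negbK -mE.
move=> ij; rewrite (divn_eq i (2 ^ k.+1)) (divn_eq j (2 ^ k.+1)).
by rewrite addnC h addnC h ij.
Qed.

Let ind x : nat := sval (cid (C2P _ (chi x))).

Let chi_ind x : chi x = zetaC k ^+ (ind x).
Proof. exact: (svalP (cid (C2P _ (chi x)))). Qed.

Let beta v : set X := [set x | ext v (ind x)].

Let betaE v x i : chi x = zetaC k ^+ i -> beta v x = ext v i :> Prop.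
Proof. by rewrite chi_ind => /zetaC_eq h; rewrite /beta /= (ext_mod _ _ _ h). Qed.

Let Fixm_beta v : Fixm (beta v) = K.
Proof.
apply: (maximal_Fixm abX) => // x Kx; rewrite /Fixm /= lshiftE.
have h z : beta v (x^-1 * z) <-> ~ beta v z.
  have KV : K x^-1 by have /(cogroup2P abX)[_ _ + _] := cK; apply.
  rewrite (betaE v (x^-1 * z) (ind z + m)); last first.
    by rewrite abX chiM expgnDr -chi_ind; congr (_ * _); exact/chi_cogroup.
  by rewrite extD; split=> /negP.
by apply/seteqP; split=> z /h.
Qed.

Section Generator.
Context (g : X) (chig : chi g = zetaC k).

Let tup A : m.-tuple bool := [tuple `[< A (g ^+ i) >] | i < m].

Let extS A i : Fixm A = K -> ext (tup A) i = `[< A (g ^+ i) >].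
Proof.
move=> AK; elim/ltn_ind: i => i IHi; have [im|mi] := ltnP i m.
  rewrite /ext modn_small// divn_small// addbF.
  by rewrite (nth_map (Ordinal im)) ?size_enum_ord ?nth_enum_ord// val_enum_ord.
rewrite -(subnK mi) extD IHi; last by rewrite ltn_subrL m_gt0 (leq_trans m_gt0).
have Am : Fixm A (g ^+ m) by rewrite AK; apply/chi_cogroup; rewrite chiX chig.
rewrite -asbool_neg; apply: asbool_equiv_eq.
have : A (g ^+ (i - m)) = ~ A (g ^+ m * g ^+ (i - m)).
  by have := congr1 (@^~ (g ^+ m * g ^+ (i - m))) Am; rewrite lshiftE /= mulKg.
by rewrite expgnDr abX => ->; split=> [|h]; [exact: contrapT|exact].
Qed.

Let betaK A : Fixm A = K -> beta (tup A) = A.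
Proof.
move=> AK; apply/seteqP.
have AE x y : chi x = chi y -> A x = A y.
  move=> xy; have : x^-1 ** A = y^-1 ** A by apply/lshift_chi => //; rewrite !chiV xy.
  by move=> /(congr1 (@^~ 1)); rewrite !lshiftE /= !invgK !mulg1.
have h x : beta (tup A) x = A x.
  rewrite (betaE _ _ _ (chi_ind x)) extS// asboolE; apply: AE.
  by rewrite chiX chig -chi_ind.
by split=> x; rewrite h.
Qed.

Let tupK v : tup (beta v) = v.
Proof.
apply: eq_from_tnth => i; rewrite tnth_mktuple (betaE _ _ i) ?chiX ?chig//.
by rewrite asboolb /ext modn_small// divn_small// addbF (tnth_nth false).
Qed.

(** The shift by [g] read on codes. Its cycles are the orbits of twin sets, all of length
    2^(k+1). *)
Let sigma v := tup (g ** beta v).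

Let beta_iter i v : beta (iter i sigma v) = g ^+ i ** beta v.
Proof.
elim: i => [|i IHi]; first by rewrite lshift1.
rewrite iterS /sigma betaK ?Fixm_lshift ?IHi ?expgS ?lshiftM//.
by rewrite Fixm_lshift.
Qed.

Let sigma_inj : injective sigma.
Proof.
move=> u v /(congr1 beta); rewrite !(beta_iter 1) => /lshift_inj/(congr1 tup).
by rewrite !tupK.
Qed.

Let iter_sigma v i j : iter i sigma v = iter j sigma v <-> i = j %[mod 2 ^ k.+1].
Proof.
rewrite -zetaC_eq -chig -!chiX -(lshift_chi (beta v))// -!beta_iter.
by split=> [->//|/(congr1 tup)]; rewrite !tupK.
Qed.

Let order_sigma v : order sigma v = (2 ^ k.+1)%N.
Proof.
have N0 : (0 < 2 ^ k.+1)%N by rewrite expn_gt0.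
apply/eqP; rewrite eqn_leq; apply/andP; split.
  rewrite leqNgt; apply/negP => h; have := findex_iter h.
  have -> : iter (2 ^ k.+1) sigma v = v by apply/(iter_sigma v _ 0); rewrite modnn mod0n.
  by rewrite findex0 => e; rewrite -e in N0.
apply: dvdn_leq; first exact: order_gt0.
apply/eqP; have /(iter_sigma v _ 0) := iter_order sigma_inj v.
by rewrite mod0n.
Qed.

Let R : {set m.-tuple bool} := [set v | froots sigma v]%SET.

(** The 2^(2^k) codes split into cycles of length 2^(k+1), which leaves 2^(2^k - (k+1)) cycles: the
    exponent in [Zcube k.+1]. *)
Let card_R : #|{: Zcube k.+1}| = #|R|.
Proof.
have N0 : (0 < 2 ^ k.+1)%N by rewrite expn_gt0.
have km : (k.+1 <= m)%N by exact: ltn_expl.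
have := @fcard_order_set _ sigma sigma_inj (2 ^ k.+1)%N predT.
rewrite /n_comp_mem => /(_ _ _) h; apply/eqP; rewrite -(eqn_pmul2r N0); apply/eqP.
have -> : #|{: Zcube k.+1}| = (2 ^ (m - k.+1))%N.
  by rewrite card_ffun card_bool card_ord.
have cT : #|predT : {pred m.-tuple bool}| = (2 ^ m)%N by rewrite card_tuple card_bool.
rewrite -expnD subnK// -cT -h.
- by congr (_ * _)%N; apply: eq_card => v; rewrite !inE andbT.
- by apply/fintype.subsetP => v _; rewrite inE order_sigma.
- by [].
Qed.

Let rho (z : Zcube k.+1) : m.-tuple bool := enum_val (cast_ord card_R (enum_rank z)).

Lemma exists_coordinates : exists (co : set X -> C2 k.+1 * Zcube k.+1)
    (uc : C2 k.+1 * Zcube k.+1 -> set X),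
  [/\ forall p, Fixm (uc p) = K, forall A, Fixm A = K -> uc (co A) = A,
      forall p, co (uc p) = p &
      forall x p, uc (chi x * p.1, p.2) = x ** uc p].
Proof.
have /choice[pre preP] h : exists x, chi x = h.
  have : range chi h by rewrite chiR.
  by move=> [x _ <-]; exists x.
pose uc (p : C2 k.+1 * Zcube k.+1) := pre p.1 ** beta (rho p.2).
have ucF p : Fixm (uc p) = K by rewrite Fixm_lshift.
have ucM x p : uc (chi x * p.1, p.2) = x ** uc p.
  by rewrite /uc -lshiftM; apply/lshift_chi => //; rewrite preP chiM preP.
have rhoR (z : Zcube k.+1) : froot sigma (rho z) = rho z.
  by apply/eqP; have := enum_valP (cast_ord card_R (enum_rank z)); rewrite inE.
have symc := fconnect_sym sigma_inj.
have uc_inj : injective uc.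
  move=> [h z] [h' z'] e.
  have [i hi] := C2P _ (h'^-1 * h).
  have e' : beta (rho z') = g ^+ i ** beta (rho z).
    apply: (@lshift_inj _ (pre h')); rewrite -[LHS]e -lshiftM.
    by apply/lshift_chi => //; rewrite chiM chiX chig !preP -hi mulVKg.
  have zz : z = z'.
    apply: (can_inj (@enum_rankK _)); apply: (@cast_ord_inj _ _ card_R).
    apply: enum_val_inj; rewrite -!/(rho _) -(rhoR z) -(rhoR z').
    apply/eqP; rewrite root_connect//.
    have -> : rho z' = iter i sigma (rho z) by rewrite -[LHS]tupK e' -beta_iter tupK.
    exact: fconnect_iter.
  rewrite -zz in e *; congr pair.
  by have := e => /(lshift_chi _ _ _ (Fixm_beta _)); rewrite !preP.
have uc_surj A : Fixm A = K -> exists p, uc p = A.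
  move=> AK; pose v := tup A; pose r := froot sigma v.
  have rR : r \in R by rewrite inE roots_root.
  pose z : Zcube k.+1 := enum_val (cast_ord (esym card_R) (enum_rank_in rR r)).
  have rz : rho z = r by rewrite /rho enum_valK cast_ordKV enum_rankK_in.
  exists (zetaC k ^+ findex sigma r v, z).
  have vE : v = iter (findex sigma r v) sigma r.
    by rewrite iter_findex// symc connect_root.
  rewrite /uc /= rz -[RHS](betaK _ AK) -/v [in RHS]vE beta_iter.
  apply/lshift_chi => //.
  by rewrite preP chiX chig.
have /choice[co coP] A : exists p, Fixm A = K -> uc p = A.
  have [/uc_surj[p <-]|nK] := pselect (Fixm A = K); first by exists p.
  by exists (1, [ffun=> false]).
exists co, uc; split=> // p; apply: uc_inj; exact: coP.
Qed.

End Generator.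
End Coordinates.

(** * Characters and coordinates attached to the classes of 2-cogroups *)

Section Charts.
Context {X : groupType} (abX : forall x y : X, x * y = y * x).
Implicit Types (x y z : X) (A B : set X) (K : set X) (F G : PPset X).

Local Notation S := (superextension X).
Local Notation op := (superext_op X).
Local Notation maxK := (@maximal_cogroup2 X).

Lemma conj_class_abelian K : conj_class K = [set K].
Proof.
have h x : conjset x K = K.
  have xa a : x * a * x^-1 = a by rewrite abX mulgA mulVg mul1g.
  by apply/seteqP; split=> [_ [a Ka <-]|a Ka]; [rewrite xa|exists a].
by apply/seteqP; split=> [_ [x _ <-]|_ ->]; [|exists 1].
Qed.

Lemma char_group_abelian K : char_group K = [set x ** setmul K K | x in setT].
Proof.
rewrite /char_group; congr image; apply/seteqP; split=> // x _.
have : conj_class K (conjset x K) by exists x.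
by rewrite conj_class_abelian.
Qed.

Lemma setmul_coset N x y : subgroup N -> setmul (x ** N) (y ** N) = (x * y) ** N.
Proof.
move=> [N1 NM NV]; apply/seteqP; split.
  move=> _ [_ [a Na <-] [_ [b Nb <-] <-]]; exists (a * b); first exact: NM.
  by rewrite !mulgA; congr (_ * b); rewrite -!mulgA (abX y).
move=> _ [a Na <-]; exists (x * a); first by exists a.
exists y; first by exists 1 => //; rewrite mulg1.
by rewrite -!mulgA (abX a).
Qed.

Lemma coset_eq N x y : subgroup N -> x ** N = y ** N <-> N (y^-1 * x).
Proof.
move=> [N1 NM NV]; split=> [e|Nyx].
  have : (x ** N) x by exists 1 => //; rewrite mulg1.
  by rewrite e lshiftE.
rewrite -(lshiftVK y (x ** N)) -(lshiftM y^-1 x); congr (_ ** _); rewrite lshiftE.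
apply/seteqP; split=> z /= Nz; last by apply: NM => //; exact: NV.
by rewrite -(mulVKg (y^-1 * x) z); exact: NM.
Qed.

(* Coordinates on the twin sets attached to the class C of a maximal 2-cogroup. *)
Record chart (k : nat) (C : set (set X)) := Chart {
  ch_K : set X;
  ch_chi : X -> C2 k.+1;
  ch_co : set X -> C2 k.+1 * Zcube k.+1;
  ch_uc : C2 k.+1 * Zcube k.+1 -> set X;
  ch_max : maxK ch_K;
  ch_class : C = [set ch_K];
  ch_chiM : forall x y, ch_chi (x * y) = ch_chi x * ch_chi y;
  ch_chi1 : forall x, ch_chi x = 1 <-> setmul ch_K ch_K x;
  ch_chiR : forall h, exists x, ch_chi x = h;
  ch_ucF : forall p, Fixm (ch_uc p) = ch_K;
  ch_coK : forall A, Fixm A = ch_K -> ch_uc (ch_co A) = A;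
  ch_ucK : forall p, ch_co (ch_uc p) = p;
  ch_ucM : forall x p, ch_uc (ch_chi x * p.1, p.2) = x ** ch_uc p }.

Lemma char_group_isogP K k : maxK K -> char_group_isog K (C2 k.+1) <->
  exists chi : X -> C2 k.+1, [/\ forall x y, chi (x * y) = chi x * chi y,
    forall x, chi x = 1 <-> setmul K K x & range chi = setT].
Proof.
move=> mK; have [cK _] := mK; have sN := setmul_subgroup abX _ cK.
rewrite /char_group_isog char_group_abelian.
set N := setmul K K in sN *; have [N1 NM NV] := sN.
split=> [[f [[_ finj fsurj] fM]]|[chi [chiM chi1 chiR]]].
  have inC x : [set x ** N | x in setT] (x ** N) by exists x.
  have chiM x y : f ((x * y) ** N) = f (x ** N) * f (y ** N).
    by rewrite -setmul_coset// fM.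
  have f1 : f (1 ** N) = 1.
    by apply: (mulgI (f (1 ** N))); rewrite -chiM !mulg1.
  exists (fun x => f (x ** N)); split=> // [x|].
    rewrite -f1; split=> [/(finj _ _ (mem_set (inC x)) (mem_set (inC 1)))|Nx].
      by move=> /(coset_eq _ _ _ sN); rewrite invg1 mul1g.
    by congr f; apply/(coset_eq _ _ _ sN); rewrite invg1 mul1g.
  apply/seteqP; split=> // h _; have [_ [x _ <-] fx] := fsurj h I.
  by exists x.
have chiV x : chi x^-1 = (chi x)^-1.
  by apply/esym/mulg1_eq; rewrite -chiM mulgV; apply/chi1.
have chiE x y : chi x = chi y <-> x ** N = y ** N.
  rewrite coset_eq// -chi1 chiM chiV.
  by split=> [->|/mulg1_eq]; rewrite ?mulVg ?invgK.
pose f (A : set X) := chi (xget 1 A).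
have fE x : f (x ** N) = chi x.
  have xN : (x ** N) x by exists 1 => //; rewrite mulg1.
  have : (x ** N) (xget 1 (x ** N)) by apply: (@xgetPex _ 1); exists x.
  by move=> [n Nn nE]; rewrite /f -nE chiM (chi1 n).2// mulg1.
exists f; split; last by move=> _ _ [x _ <-] [y _ <-]; rewrite setmul_coset// !fE.
split=> // [_ _ /set_mem[x _ <-] /set_mem[y _ <-]|h _].
  by rewrite !fE => /chiE.
have : range chi h by rewrite chiR.
by move=> [x _ <-]; exists (x ** N); [exists x|rewrite fE].
Qed.

Lemma exists_chart k (c : q_classes X (C2 k.+1)) : exists ch : chart k (val c), True.
Proof.
have [K [mK /(char_group_isogP _ _ mK)[chi [chiM chi1 chiR]] cE]] := set_valP c.
have [g _ chig] : range chi (zetaC k) by rewrite chiR.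
have [co [uc [h1 h2 h3 h4]]] := exists_coordinates abX _ mK _ _ chiM chi1 chiR _ chig.
have chR h : exists x, chi x = h.
  have : range chi h by rewrite chiR.
  by move=> [x _ <-]; exists x.
rewrite conj_class_abelian in cE.
by exists (Chart k (val c) K chi co uc mK cE chiM chi1 chR h1 h2 h3 h4).
Qed.

Definition ch k (c : q_classes X (C2 k.+1)) : chart k (val c) :=
  sval (cid (exists_chart k c)).

End Charts.

(** * The isomorphisms when there is no quasicyclic quotient *)

Section Main.
Context {X : groupType} (abX : forall x y : X, x * y = y * x).
Implicit Types (x y : X) (A B : set X) (K : set X) (F G e l : PPset X).
Context (noC2oo : ~ exists f : X -> CC,
  (forall x y, f (x * y) = (f x * f y)%R) /\ range f = C2oo).

Local Notation S := (superextension X).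
Local Notation op := (superext_op X).
Local Notation maxK := (@maximal_cogroup2 X).
Local Notation Q k := (q_classes X (C2 k.+1)).
Local Notation Kc c := (ch_K _ _ (ch abX _ c)).
Local Notation chi c := (ch_chi _ _ (ch abX _ c)).
Local Notation co c := (ch_co _ _ (ch abX _ c)).
Local Notation uc c := (ch_uc _ _ (ch abX _ c)).

(** Condition (1) enters here: it excludes the quasicyclic alternative for X/KK, so the factors of
    the products account for all maximal 2-cogroups. *)
Lemma chart_surj K : maxK K -> exists k (c : Q k), Kc c = K.
Proof.
move=> mK; have [[k hk]|/noC2oo//] := maximal_cogroup2_quotient abX _ mK.
have QK : q_classes X (C2 k.+1) (conj_class K).
  by exists K; split=> //; apply/(char_group_isogP abX).
exists k, (SigSub (mem_set QK)); set c := SigSub _.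
have vc : val c = [set K] by exact: conj_class_abelian.
have KK := etrans (esym vc) (ch_class _ _ (ch abX _ c)).
by have : [set Kc c] K by rewrite -KK.
Qed.

Lemma chart_le k k' (c : Q k) (c' : Q k') : Kc c = Kc c' -> (k <= k')%N.
Proof.
move=> cc'; have [x xz] := ch_chiR _ _ (ch abX _ c) (zetaC k).
have chiX j (d : Q j) y n : chi d (y ^+ n) = chi d y ^+ n.
  elim: n => [|n IHn].
    by apply/ch_chi1; have [] := setmul_subgroup abX _ (ch_max _ _ (ch abX _ d)).1.
  by rewrite !expgS ch_chiM IHn.
have : chi c' (x ^+ (2 ^ k'.+1)) = 1.
  rewrite chiX; have [i ->] := C2P _ (chi c' x).
  rewrite -expgnA; apply: (zetaC_eq _ _ 0).2; by rewrite mod0n modnMl.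
move=> /ch_chi1; rewrite -cc' => /ch_chi1; rewrite chiX xz => h.
have /(zetaC_eq _ _ 0) : zetaC k ^+ (2 ^ k'.+1) = zetaC k ^+ 0 by [].
by rewrite mod0n => /eqP; rewrite -/(dvdn _ _) dvdn_Pexp2l.
Qed.

Lemma chart_inj k k' (c : Q k) (c' : Q k') : Kc c = Kc c' ->
  existT (fun k => q_classes X (C2 k.+1) : Type) k c = existT _ k' c'.
Proof.
move=> cc'; have kk' : k = k'.
  by apply/eqP; rewrite eqn_leq (chart_le _ _ _ _ cc') (chart_le _ _ _ _ (esym cc')).
subst k'; congr existT; apply: val_inj.
by rewrite (ch_class _ _ (ch abX _ c)) (ch_class _ _ (ch abX _ c')) cc'.
Qed.

Lemma mtwin_chart A : mtwin A -> exists k (c : Q k), Fixm A = Kc c.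
Proof. by move=> /chart_surj[k [c cA]]; exists k, c. Qed.

Lemma mtwin_uc k (c : Q k) p : mtwin (uc c p).
Proof. by rewrite /mtwin ch_ucF; exact: ch_max. Qed.

Lemma ch_coM k (c : Q k) x A : Fixm A = Kc c ->
  co c (x ** A) = (chi c x * (co c A).1, (co c A).2).
Proof. by move=> AK; rewrite -[A in LHS](ch_coK _ _ (ch abX _ c))// -ch_ucM ch_ucK. Qed.

(** Shifts act through the character on the first coordinate only, so the hypothesis on [psi] is all
    of equivariance. *)
Lemma superextension_charts
    (psi : forall k, Q k -> C2 k.+1 * Zcube k.+1 -> C2 k.+1 * Zcube k.+1) :
  (forall k (c : Q k) h p, psi k c (h * p.1, p.2) =
     (h * (psi k c p).1, (psi k c p).2)) ->
  exists F, S F /\ forall k (c : Q k) p, tr F (uc c p) = uc c (psi k c p).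
Proof.
move=> psiM.
have /choice[Psi PsiP] A : exists B, forall k (c : Q k), Fixm A = Kc c ->
    B = uc c (psi k c (co c A)).
  have [[k [c cA]]|nA] := pselect (exists k (c : Q k), Fixm A = Kc c); last first.
    by exists A => k c cA; case: nA; exists k, c.
  exists (uc c (psi k c (co c A))) => k' c' cA'.
  have := chart_inj _ _ c c' (etrans (esym cA) cA').
  (* The indices of [c] and [c'] agree only propositionally, so the equality is used on dependent
     pairs. *)
  by move=> /(congr1 (fun s : {k & Q k : Type} =>
    uc (projT2 s) (psi _ (projT2 s) (co (projT2 s) A)))).
have [A mA|x A mA|F sF FP] := superextension_ext_max abX Psi.
- by have [k [c cA]] := mtwin_chart _ mA; rewrite (PsiP _ _ _ cA) ch_ucF.
- have [k [c cA]] := mtwin_chart _ mA.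
  rewrite (PsiP _ _ _ cA) (PsiP (x ** A) k c) ?Fixm_lshift// ch_coM// psiM.
  by rewrite ch_ucM.
- exists F; split=> // k c p; rewrite FP; last exact: mtwin_uc.
  by rewrite (PsiP _ k c) ?ch_ucF// ch_ucK.
Qed.

Local Notation Zk k := (Zcube k.+1).

Lemma orbit_valued_chart b e : representatives b -> orbit_valued b e -> forall A,
  [\/ tr e A = setT, tr e A = set0 | exists k (c : Q k) x, tr e A = x ** b (Kc c)].
Proof.
move=> bP eO A; have [->|->|[K [x [mK eA]]]] := eO A;
  [by constructor 1|by constructor 2|constructor 3].
by have [k [c cK]] := chart_surj _ mK; exists k, c, x; rewrite cK.
Qed.

Lemma finite_Zcube k : finite_set [set: Zcube k].
Proof. exact: finite_finset. Qed.

Lemma minimal_left_ideal_isomorphic (L : set (PPset X)) :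
    minimal_left_ideal op S L ->
  top_isomorphic op L (@qprod_mul X (fun k => (C2 k * Zcube k)%type)
    (fun k => pair_mul *%g (@leftzero_mul (Zcube k)))).
Proof.
move=> mL; have [[LS [e0 Le0] Lop] _] := mL; have se0 := LS _ Le0.
have [b bP] := @exists_representatives X abX.
have [e ce] := exists_collapsing abX _ bP; have [se _ eb eO] := ce.
(* [e'] lies in [L], generates it, and takes its twin values in the orbits of the sets [a K]. *)
pose e' := op e e0; have Le' : L e' by exact: Lop.
have se' := LS _ Le'; have LE := minimal_left_idealE _ _ mL Le'.
pose a K := tr e' (b K).
have aP : representatives a by move=> K mK; rewrite /a Fixm_tr_max ?bP// /mtwin bP.
have e'O : orbit_valued a e'.
  move=> A; rewrite tr_op; have [->|->|[K [x [mK eA]]]] := eO (tr e0 A);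
    [by constructor 1|by constructor 2|constructor 3].
  have mbK : mtwin (b K) by rewrite /mtwin bP.
  have mb : mtwin (tr e0 (b K)) by rewrite /mtwin Fixm_tr_max.
  have [y ey] := orbit_valued_mtwin abX _ _ _ se bP eO mb.
  rewrite Fixm_tr_max// bP// in ey.
  exists K, (x * y^-1); split=> //.
  by rewrite eA /a tr_op ey lshiftM lshiftK.
have e'C := orbit_valued_chart _ _ aP e'O.
have aF k (c : Q k) : Fixm (a (Kc c)) = Kc c by apply: aP; exact: ch_max.
pose al k (c : Q k) := co c (a (Kc c)).
have alE k (c : Q k) : uc c (al k c) = a (Kc c) by rewrite /al ch_coK.
pose eta k (c : Q k) p := (co c (tr e' (uc c p))).1 * (al k c).1^-1.
have FE k (c : Q k) p : Fixm (tr e' (uc c p)) = Kc c.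
  by rewrite Fixm_tr_max ?ch_ucF//; exact: mtwin_uc.
have mulC k (h h' : C2 k) : h * h' = h' * h by exact: C2_mulC.
(* On the twin sets of the chart c, the product of L becomes t * t' = eta(t') t,
   so that (eta, orbit) are the coordinates of the right-hand side. *)
have etaE k (c : Q k) p x : tr e' (uc c p) = x ** a (Kc c) -> chi c x = eta k c p.
  by move=> e1; rewrite /eta e1 ch_coM// mulgK.
have eta_orb k (c : Q k) p :
    exists2 x, tr e' (uc c p) = x ** a (Kc c) & chi c x = eta k c p.
  have [x] := orbit_valued_mtwin abX _ _ _ se' aP e'O (mtwin_uc k c p).
  by rewrite ch_ucF => e1; exists x => //; exact: etaE.
have etaM k (c : Q k) h p : eta k c (h * p.1, p.2) = h * eta k c p.
  have [x xh] := ch_chiR _ _ (ch abX _ c) h.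
  by rewrite /eta -xh ch_ucM tr_lshift ch_coM ?FE//= mulgA.
(* The point of the orbit [q.2] at which [eta] equals [q.1]: a change of coordinates from (h, z) to
   (eta, z). *)
pose t k (c : Q k) (q : C2 k.+1 * Zk k) : C2 k.+1 * Zk k :=
  (q.1 * (eta k c (1, q.2))^-1, q.2).
have eta_t k (c : Q k) q : eta k c (t k c q) = q.1.
  by have := etaM k c (t k c q).1 (1, q.2); rewrite /= mulg1 => ->; rewrite mulgVK.
have t_eta k (c : Q k) p : t k c (eta k c p, p.2) = p.
  have := etaM k c p.1 (1, p.2); rewrite /= mulg1 -surjective_pairing /t /= => ->.
  by rewrite mulgK -surjective_pairing.
pose U := qprod X (fun k => (C2 k * Zcube k)%type).
have /choice[Y YP] (u : U) : exists F, S F /\ forall k (c : Q k),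
    tr F (a (Kc c)) = uc c (t k c (u k c)).
  (* The factor [(al k c).1^-1] makes the map send the coordinates of [a (Kc c)] to
     [t k c (u k c)]. *)
  have [k c h p /=|F [sF FP]] := superextension_charts (fun k c p =>
      (p.1 * (al k c).1^-1 * (t k c (u k c)).1, (t k c (u k c)).2)).
    by rewrite !mulgA.
  exists F; split=> // k c; rewrite -{1}alE FP mulgV mul1g.
  by rewrite -surjective_pairing.
pose g (u : U) := op (Y u) e'.
have op_eq' F G : S F -> S G ->
    (forall k (c : Q k), tr F (a (Kc c)) = tr G (a (Kc c))) -> op F e' = op G e'.
  move=> sF sG FG; apply: (op_eq a) => // K /chart_surj[k [c <-]]; exact: FG.
have tr_g u k (c : Q k) : tr (g u) (b (Kc c)) = uc c (t k c (u k c)).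
  by rewrite tr_op -/(a (Kc c)) (YP u).2.
apply: (compact_top_isomorphic _ _ _ _ _ g (fun k c => (1, [ffun=> false]))).
- exact: PPset_hausdorff.
- apply: qprod_compact => k; rewrite -setXTT; apply: finite_setX.
    exact: finite_C2.
  exact: finite_Zcube.
- apply: continuous_prod => A.
  have gA u : g u A = `[< tr (Y u) (tr e' A) 1 >].
    by apply/idP/asboolP; rewrite -tr_op tr1.
  have [e1|e1|[k [c [x e1]]]] := e'C A.
  - rewrite (_ : (fun u => g u A) = fun=> true); first exact: cst_continuous.
    by apply: funext => u; rewrite gA e1 trT ?asboolT//; exact: (YP u).1.
  - rewrite (_ : (fun u => g u A) = fun=> false); first exact: cst_continuous.
    by apply: funext => u; rewrite gA e1 tr0 ?asboolF//; exact: (YP u).1.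
  rewrite (_ : (fun u => g u A) = fun u => `[< (x ** uc c (t k c (u k c))) 1 >]); last first.
    by apply: funext => u; rewrite gA e1 tr_lshift (YP u).2.
  exact: (qprod_discrete_continuous X (fun k => (C2 k * Zcube k)%type) _ k c
    (fun q => `[< (x ** uc c (t k c q)) 1 >])).
- move=> u v guv; apply: functional_extensionality_dep => k; apply: funext => c.
  have := congr1 (fun l => co c (tr l (b (Kc c)))) guv; rewrite !tr_g !ch_ucK => tt'.
  have := congr1 (eta k c) tt'; rewrite !eta_t => e1.
  have := congr1 snd tt' => /= e2.
  by rewrite [u k c]surjective_pairing [v k c]surjective_pairing e1 e2.
- rewrite LE; apply/seteqP; split=> [_ [u _ <-]|_ [y sy <-]].
    by exists (Y u) => //; exact: (YP u).1.
  exists (fun k c => (eta k c (co c (tr y (a (Kc c)))), (co c (tr y (a (Kc c)))).2)) => //.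
  apply: op_eq' => [||k c]; [exact: (YP _).1|by []|].
  rewrite (YP _).2 t_eta ch_coK// Fixm_tr_max ?aF// /mtwin aF; exact: ch_max.
- move=> u v; rewrite /g superext_opA.
  have [su sv] := ((YP u).1, (YP v).1).
  apply: op_eq' => [||k c]; [exact: (YP _).1|by do ?apply: superextension_op|].
  rewrite (YP _).2 tr_op (YP v).2 tr_op; have [x -> xe] := eta_orb k c (t k c (v k c)).
  rewrite tr_lshift (YP u).2 -ch_ucM xe eta_t /t /= /leftzero_mul.
  by congr (uc c (_, _)); rewrite (mulC _ (u k c).1) !mulgA.
Qed.

(** Unlike a collapsing element, this one keeps every twin set with a maximal 2-cogroup, so its left
    ideal records whole equivariant self-maps. *)
Lemma exists_retraction : exists F,
  [/\ S F, forall A, mtwin A -> tr F A = A &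
      forall A, [\/ tr F A = setT, tr F A = set0 |
        exists k (c : Q k) p, tr F A = uc c p]].
Proof.
have [A tA|x A B [mB AB]|F [sF FP FN]] :=
  superextension_ext abX (fun A B => mtwin B /\ (mtwin A -> B = A)).
- have [mA|nA] := pselect (mtwin A); first by exists A.
  have [M mM AM] := cogroup2_le_max abX _ (cogroup2_Fixm abX _ tA).
  have [B BM] := exists_Fixm abX _ mM.
  exists B; last by rewrite BM.
  by split=> //; rewrite /mtwin BM.
- by split=> [|/(mtwin_lshift abX)/AB->//]; exact/(mtwin_lshift abX).
- exists F; split=> // [A mA|A].
    by apply: (FP A _).2 => //; exact: mtwin_twin.
  have [tA|/FN[]] := pselect (twin A); [|by constructor 1|by constructor 2].
  have [k [c cA]] := mtwin_chart _ (FP A tA).1.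
  by constructor 3; exists k, c, (co c (tr F A)); rewrite ch_coK.
Qed.

Lemma finite_wreath k : finite_set [set: wreath (C2 k.+1) (Zk k)].
Proof.
rewrite -[setT]setXTT; apply: finite_setX; last exact: finite_finset.
have -> : [set: {ffun Zk k -> C2 k.+1}] =
    [set [ffun z => zetaC k ^+ (w z : 'I__)] | w in [set: {ffun Zk k -> 'I_(2 ^ k.+1)}]].
  apply/seteqP; split=> // h _; have [w wP] := choice (fun z => C2P k (h z)).
  by exists [ffun z => w z] => //; apply/ffunP => z; rewrite !ffunE.
exact/finite_image/finite_finset.
Qed.

Lemma exists_principal_left_ideal : exists L : set (PPset X),
  principal_left_ideal op S L /\
  top_isomorphic op L (@qprod_mul X (fun k => wreath (C2 k) (Zcube k))
    (fun k => @wreath_mul (C2 k) (Zcube k))).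
Proof.
have [r [sr rid rO]] := exists_retraction.
have mulC k (h h' : C2 k) : h * h' = h' * h by exact: C2_mulC.
exists [set op s r | s in S]; split; first by exists r.
pose U := qprod X (fun k => wreath (C2 k) (Zcube k)).
(* An equivariant self-map is determined at the points (1, z): [w.1] stores the group part of the
   value and [w.2] its orbit. *)
pose act k (w : wreath (C2 k.+1) (Zk k)) (p : C2 k.+1 * Zk k) :=
  (p.1 * w.1 p.2, w.2 p.2).
have /choice[Y YP] (w : U) : exists F, S F /\ forall k (c : Q k) p,
    tr F (uc c p) = uc c (act k (w k c) p).
  apply: superextension_charts (fun k c => act k (w k c)) _ => k c h p.
  by rewrite /act /= mulgA.
pose g (w : U) := op (Y w) r.
have op_eq' F G : S F -> S G ->
    (forall k (c : Q k) z, tr F (uc c (1, z)) = tr G (uc c (1, z))) -> op F r = op G r.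
  move=> sF sG FG; apply: tr_inj => A; rewrite !tr_op.
  have [->|->|[k [c [[h z] ->]]]] := rO A; rewrite ?trT ?tr0//.
  have [x xh] := ch_chiR _ _ (ch abX _ c) h.
  have -> : uc c (h, z) = x ** uc c (1, z) by rewrite -ch_ucM /= mulg1 xh.
  by rewrite !tr_lshift FG.
have tr_g w k (c : Q k) p : tr (g w) (uc c p) = uc c (act k (w k c) p).
  by rewrite tr_op rid ?(YP w).2//; exact: mtwin_uc.
apply: (compact_top_isomorphic _ _ _ _ _ g (fun k c => ([ffun=> 1], [ffun z => z]))).
- exact: PPset_hausdorff.
- by apply: qprod_compact => k; exact: finite_wreath.
- apply: continuous_prod => A.
  have gA w : g w A = `[< tr (Y w) (tr r A) 1 >].
    by apply/idP/asboolP; rewrite -tr_op tr1.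
  have [e1|e1|[k [c [p e1]]]] := rO A.
  - rewrite (_ : (fun u => g u A) = fun=> true); first exact: cst_continuous.
    by apply: funext => u; rewrite gA e1 trT ?asboolT//; exact: (YP u).1.
  - rewrite (_ : (fun u => g u A) = fun=> false); first exact: cst_continuous.
    by apply: funext => u; rewrite gA e1 tr0 ?asboolF//; exact: (YP u).1.
  rewrite (_ : (fun w => g w A) = fun w => `[< uc c (act k (w k c) p) 1 >]); last first.
    by apply: funext => w; rewrite gA e1 (YP w).2.
  exact: (qprod_discrete_continuous X (fun k => wreath (C2 k) (Zcube k)) _ k c
    (fun w => `[< uc c (act k w p) 1 >])).
- move=> u v guv; apply: functional_extensionality_dep => k; apply: funext => c.
  have e z : act k (u k c) (1, z) = act k (v k c) (1, z).
    by have := congr1 (fun l => co c (tr l (uc c (1, z)))) guv; rewrite !tr_g !ch_ucK.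
  rewrite [u k c]surjective_pairing [v k c]surjective_pairing; congr pair.
    by apply/ffunP => z; have := congr1 fst (e z); rewrite /act /= !mul1g.
  by apply/ffunP => z; exact: (congr1 snd (e z)).
- apply/seteqP; split=> [_ [u _ <-]|_ [y sy <-]].
    by exists (Y u) => //; exact: (YP u).1.
  pose q k (c : Q k) z := co c (tr y (uc c (1, z))).
  exists (fun k c => ([ffun z => (q k c z).1], [ffun z => (q k c z).2])) => //.
  apply: op_eq' => [||k c z]; [exact: (YP _).1|by []|].
  rewrite (YP _).2 /act /= !ffunE mul1g -surjective_pairing /q ch_coK//.
  rewrite Fixm_tr_max ?ch_ucF//; exact: mtwin_uc.
- move=> u v; rewrite /g superext_opA.
  have [su sv] := ((YP u).1, (YP v).1).
  apply: op_eq' => [||k c z]; [exact: (YP _).1|by do ?apply: superextension_op|].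
  rewrite (YP _).2 tr_op (YP v).2 tr_op rid; last exact: mtwin_uc.
  rewrite (YP u).2 /act /= !ffunE /= !mul1g.
  (* Composition yields the group factors in the order opposite to that of [wreath_mul]. *)
  by congr (uc c (_, _)); exact: mulC.
Qed.

(** In the coordinates of the minimal left ideal Sex, the idempotent [i] has first coordinates 1.
    Left zero multiplication makes its local group the set of elements with the second coordinates
    of [i]. *)
Lemma maximal_subgroup_isomorphic (G : set (PPset X)) :
    maximal_subgroup_in op S (minimal_ideal op S) G ->
  top_isomorphic op G (@qprod_mul X (fun k => C2 k) (fun k => *%g)).
Proof.
have [b bP] := @exists_representatives X abX.
have [e ce] := exists_collapsing abX _ bP; have [se _ eb eO] := ce.
move=> /(maximal_subgroupP abX b e G ce)[i [si mi ii ->]].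
have : [set z | exists2 y, S y & exists2 x, S x & z = op (op y e) x] i.
  by rewrite -(minimal_idealE abX _ _ ce).
move=> [y sy [x sx iE]].
have mL := collapsing_minimal abX _ _ _ ce sx; set L := [set _ | _ in _] in mL.
have Li : L i by exists y => //; rewrite iE superext_opA.
have [[LS _ Lop] _] := mL.
have [f [g [[gL gK] fK fM _ gc]]] := minimal_left_ideal_isomorphic _ mL.
have fi k (c : Q k) : (f i k c).1 = 1.
  have := congr1 (fun u => (u k c).1) (fM _ _ Li Li).
  by rewrite ii /= => e1; apply: (mulgI (f i k c).1); rewrite -e1 mulg1.
pose j (h : qprod X (fun k => C2 k)) : qprod X (fun k => (C2 k * Zcube k)%type) :=
  fun k c => (h k c, (f i k c).2).
have ext (D : nat -> choiceType) (u v : qprod X D) : (forall k c, u k c = v k c) -> u = v.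
  by move=> uv; apply: functional_extensionality_dep => k; apply: funext => c.
apply: (compact_top_isomorphic _ _ _ _ _ (g \o j) (fun k c => 1)).
- exact: PPset_hausdorff.
- by apply: qprod_compact => k; exact: finite_C2.
- move=> h; apply: continuous_comp; last exact: gc.
  apply: continuous_prod => k; apply: continuous_prod => c.
  exact: (qprod_discrete_continuous X (fun k => C2 k)
    (discrete_topology (C2 k.+1 * Zcube k.+1)%type) k c (fun a => (a, (f i k c).2))).
- move=> h h' /(congr1 f) /=; rewrite !gK => e1; apply: ext => k c.
  by have := congr1 (fun u => (u k c).1) e1.
- apply/seteqP; split=> [_ [h _ <-]|l [sl il li]].
    split; first exact: (LS _ (gL (j h))).
    + rewrite -[LHS]fK; last exact: Lop (LS _ Li) (gL _).
      rewrite /= fM// gK; congr g; apply: ext => k c.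
      by rewrite /qprod_mul /pair_mul /leftzero_mul /= fi mul1g.
    + rewrite -[LHS]fK; last exact: Lop (LS _ (gL _)) Li.
      rewrite /= fM// gK; congr g; apply: ext => k c.
      by rewrite /qprod_mul /pair_mul /leftzero_mul /= fi mulg1.
  have Ll : L l by rewrite -li; exact: Lop.
  exists (fun k c => (f l k c).1) => //=; rewrite -[RHS]fK//; congr g.
  apply: ext => k c; rewrite /j [RHS]surjective_pairing; congr pair.
  by have := congr1 (fun u => (u k c).2) (fM _ _ Li Ll); rewrite il.
- move=> h h' /=; rewrite -[RHS]fK; last exact: Lop (LS _ (gL _)) (gL _).
  by rewrite fM// !gK.
Qed.

End Main.
(** The cycle closes through (1): a compact maximal subgroup excludes a map onto C_{2^oo}, and (5)
    and (6) each yield such a subgroup because their products have finite factors. From (3), (1)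
    follows by the group built around [arc], and (4) is then reached through (5). *)
Theorem theorem19p3 (X : groupType)
    (abelianX : forall x y : X, (x * y = y * x)%g) :
  [<-> (* 1 *)
       ~ (exists f : X -> CC,
            (forall x y : X, f (x * y)%g = (f x * f y)%R) /\
            range f = C2oo);
       (* 2 *)
       forall G : set (PPset X),
         maximal_subgroup_in (superext_op X) (superextension X)
           (minimal_ideal (superext_op X) (superextension X)) G ->
         top_isomorphic (superext_op X) G
           (@qprod_mul X (fun k => C2 k) (fun k => *%g));
       (* 3 *)
       forall G : set (PPset X),
         maximal_subgroup_in (superext_op X) (superextension X)
           (minimal_ideal (superext_op X) (superextension X)) G ->
         topological_group (superext_op X) G;
       (* 4 *)
       exists G : set (PPset X),
         maximal_subgroup_in (superext_op X) (superextension X)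
           (minimal_ideal (superext_op X) (superextension X)) G /\
         compact G;
       (* 5 *)
       forall L : set (PPset X),
         minimal_left_ideal (superext_op X) (superextension X) L ->
         top_isomorphic (superext_op X) L
           (@qprod_mul X (fun k => (C2 k * Zcube k)%type)
             (fun k => pair_mul *%g (@leftzero_mul (Zcube k))));
       (* 6 *)
       exists L : set (PPset X),
         principal_left_ideal (superext_op X) (superextension X) L /\
         top_isomorphic (superext_op X) L
           (@qprod_mul X (fun k => wreath (C2 k) (Zcube k))
             (fun k => @wreath_mul (C2 k) (Zcube k)))].
Proof.
have h42 : (exists G : set (PPset X),
    maximal_subgroup_in (superext_op X) (superextension X)
      (minimal_ideal (superext_op X) (superextension X)) G /\ compact G) ->
    ~ (exists f : X -> CC, (forall x y : X, f (x * y)%g = (f x * f y)%R) /\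
         range f = C2oo).
  by move=> [G [mG cG]] [f [fM fR]]; exact: (maximal_subgroup_not_compact abelianX f fM fR G mG).
have h54 : (forall L : set (PPset X),
    minimal_left_ideal (superext_op X) (superextension X) L ->
    top_isomorphic (superext_op X) L
      (@qprod_mul X (fun k => (C2 k * Zcube k)%type)
        (fun k => pair_mul *%g (@leftzero_mul (Zcube k))))) ->
    exists G : set (PPset X),
      maximal_subgroup_in (superext_op X) (superextension X)
        (minimal_ideal (superext_op X) (superextension X)) G /\ compact G.
  move=> h5; have [b bP] := @exists_representatives X abelianX.
  have [e ce] := exists_collapsing abelianX _ bP; have [se _ _ _] := ce.
  have mL := collapsing_minimal abelianX _ _ _ ce se.
  apply: (exists_compact_maximal_subgroup abelianX _ _ _ _ mL.1 (h5 _ mL)) => k.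
  by rewrite -setXTT; apply: finite_setX; [exact: finite_C2|exact: finite_Zcube].
tfae.
- by move=> h1 G; exact: maximal_subgroup_isomorphic.
- move=> h2 G mG; apply: (qprod_C2_group X _ _ _ _ (h2 G mG)).
  case: mG => [i [_ _ [_ [u [inv [_ Gop _ _ _]]]] _ _]]; exact: Gop.
- move=> h3; apply: h54; apply: minimal_left_ideal_isomorphic => //.
  move=> [f [fM fR]]; have [G [mG]] := maximal_subgroup_not_topological abelianX f fM fR.
  by apply; exact: h3.
- by move=> /h42 h1; exact: minimal_left_ideal_isomorphic.
- by move=> /h54/h42 h1; exact: exists_principal_left_ideal.
- move=> [L [[x sx ->] iL]]; apply: h42.
  apply: (exists_compact_maximal_subgroup abelianX _ _ _ _ _ iL); first exact: finite_wreath.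
  exact: left_ideal_principal.
Qed.
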